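(* Let $\Gamma$ be a non-elementary group acting geometrically on a proper roughly geodesic hyperbolic space $(X,d)$ with basepoint $o$. Let $\mu$ be a symmetric non-elementary probability measure on $\Gamma$ with 1st moment, $(X_n)_n$ the $\mu$-random walk starting at the identity, and $\nu$ the unique $\mu$-stationary probability measure on $\partial X$. Then for every continuous function $\Phi\in C^0(\partial X\times\partial X)$ and all $\xi,\eta\in\partial X$, $$\mathbb{E}[\Phi(X_n\xi,X_n^{-1}\eta)]=\sum_{g\in\Gamma}\Phi(g\xi,g^{-1}\eta)\,\mu^{*n}(g)\xrightarrow[n\to+\infty]{}\int_{\partial X\times\partial X}\Phi\,d(\nu\otimes\nu).$$
   Context: Geometric action: by isometries, properly discontinuous and cocompact. Roughly geodesic means there is a constant $C$ such that any two points $x,y\in X$ are joined by a map $p:[0,T]\to X$, $p(0)=x$, $p(T)=y$, with $|t-t'|-C\le d(p(t),p(t'))\le|t-t'|+C$ for all $t,t'$. $\partial X$ is the Gromov boundary. Non-elementary group: not virtually cyclic (finite groups counted as virtually cyclic). A probability measure $\mu$ on $\Gamma$ is symmetric if $\mu(g)=\mu(g^{-1})$ for all $g$; a symmetric $\mu$ is non-elementary if the semigroup generated by its support (which is a group) is non-elementary; $\mu$ has a 1st moment if $\sum_g d(g.o,o)\mu(g)<\infty$. A probability $\nu$ on $\partial X$ is $\mu$-stationary if $\sum_g\mu(g)\,g_*\nu=\nu$; there is exactly one such measure here. The $\mu$-random walk starting at the identity is $X_n=H_1\cdots H_n$ with $(H_i)$ i.i.d. of law $\mu$; its law at time $n$ is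 the convolution power $\mu^{*n}$. *)

(* Defs.v *)
From HB Require Import structures.
From mathcomp Require Import all_boot all_order all_algebra.
From mathcomp Require Import all_classical all_reals all_analysis.
From mathcomp Require Import lra.

Set Implicit Arguments.
Unset Strict Implicit.
Unset Printing Implicit Defensive.

Import Order.TTheory GRing.Theory Num.Theory.
Import numFieldNormedType.Exports.

Local Open Scope classical_set_scope.
Local Open Scope ring_scope.

Section metric.
Context {R : realType} (X : metricType R).

Definition proper_space : Prop :=
  forall (x : X) (r : R), compact [set y : X | mdist x y <= r].

Definition roughly_geodesic : Prop :=
  exists C : R, forall x y : X, exists (T : R) (p : R -> X),
    [/\ 0 <= T, p 0 = x, p T = y &
        forall t t' : R, 0 <= t <= T -> 0 <= t' <= T ->
          `|t - t'| - C <= mdist (p t) (p t') <= `|t - t'| + C].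

Definition gromov_product (o x y : X) : R :=
  (mdist x o + mdist y o - mdist x y) / 2.

(* X is not assumed to be geodesic, so hyperbolicity is Gromov's four-point
   condition rather than thinness of triangles. *)
Definition gromov_hyperbolic : Prop :=
  exists delta : R, forall w x y z : X,
    Num.min (gromov_product w x y) (gromov_product w y z) - delta
      <= gromov_product w x z.

Section boundary.
Variable o : X.

Definition gromov_asymptotic (x y : nat -> X) : Prop :=
  forall M : R, \forall i & j \near \oo, M <= gromov_product o (x i) (y j).

Definition gromov_sequence (x : nat -> X) : Prop := gromov_asymptotic x x.

(* A boundary point is the set of all Gromov sequences asymptotic to a given
   one; when X is hyperbolic, [gromov_asymptotic] is an equivalence relation on
   Gromov sequences and these sets are its classes. *)
Record gromov_boundary : Type := GromovBoundary {
  bd_class : set (nat -> X);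
  bd_classP : exists2 x, gromov_sequence x &
    bd_class = [set y | gromov_sequence y /\ gromov_asymptotic x y]
}.

HB.instance Definition _ := gen_eqMixin gromov_boundary.
HB.instance Definition _ := gen_choiceMixin gromov_boundary.

(* The two inner operations compute the lower limit of (x_i | y_j)_o as i and j
   tend to infinity independently. Taking the infimum over the sequences x and y
   instead of the supremum changes the value by a bounded amount when X is
   hyperbolic, and so gives the same topology. *)
Definition bd_gromov_product (xi eta : gromov_boundary) : \bar R :=
  ereal_sup [set l | exists x y, [/\ bd_class xi x, bd_class eta y &
    l = ereal_sup [set ereal_inf [set (gromov_product o (x i) (y j))%:E
                                   | i in [set i | (N <= i)%N]
                                   & j in [set j | (N <= j)%N]]
                  | N in [set: nat]]]].

(* For hyperbolic X the sets {eta | r <= (xi | eta)_o} form a basis of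
   neighbourhoods of xi. *)
Definition bd_open (U : set gromov_boundary) : Prop :=
  forall xi, U xi -> exists r : R,
    [set eta | (r%:E <= bd_gromov_product xi eta)%E] `<=` U.

Let bd_openT : bd_open setT.
Proof. by move=> xi _; exists 0. Qed.

Let bd_openI : setI_closed bd_open.
Proof.
move=> U V oU oV xi [/oU[r rU] /oV[s sV]]; exists (Num.max r s) => eta /= h.
split; [apply: rU|apply: sV]; apply: le_trans h.
- by rewrite lee_fin le_max lexx.
- by rewrite lee_fin le_max lexx orbT.
Qed.

Let bd_open_bigU (I : Type) (f : I -> set gromov_boundary) :
  (forall i, bd_open (f i)) -> bd_open (\bigcup_i f i).
Proof.
by move=> of_ xi [i _ /of_[r rf]]; exists r => eta /rf fi; exists i.
Qed.

HB.instance Definition _ :=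
  isOpenTopological.Build gromov_boundary bd_openT bd_openI bd_open_bigU.

End boundary.
End metric.

Record isometric_action (R : realType) (G : groupType) (X : metricType R) :=
  IsometricAction {
    act :> G -> X -> X;
    act1 : forall x, act 1%g x = x;
    actM : forall (g h : G) x, act (g * h)%g x = act g (act h x);
    act_isometry : forall g x y, mdist (act g x) (act g y) = mdist x y
  }.

Section action.
Context {R : realType} {G : groupType} {X : metricType R}.
Variable a : isometric_action G X.

Definition properly_discontinuous : Prop :=
  forall K : set X, compact K ->
    finite_set [set g : G | (a g @` K) `&` K !=set0].

Definition cocompact : Prop :=
  exists2 K : set X, compact K & \bigcup_g (a g @` K) = setT.

Definition geometric_action : Prop := properly_discontinuous /\ cocompact.

Variable o : X.

Lemma actK g : cancel (a g) (a g^-1%g).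
Proof. by move=> x; rewrite -actM mulVg act1. Qed.

Lemma actVK g : cancel (a g^-1%g) (a g).
Proof. by move=> x; rewrite -actM mulgV act1. Qed.

Lemma gromov_asymptotic_act g x y : gromov_asymptotic o x y ->
  gromov_asymptotic o (a g \o x) (a g \o y).
Proof.
move=> xy M; apply: filterS (xy (M + mdist (a g o) o)) => -[i j] /=.
rewrite /gromov_product act_isometry => le_M.
have tri z : mdist z o <= mdist (a g z) o + mdist (a g o) o.
  rewrite -(act_isometry a g z o) (metric_sym (a g o) o).
  exact: metric_triangle.
move: le_M; rewrite !ler_pdivlMr// => le_M.
have := tri (x i); have := tri (y j); lra.
Qed.

Lemma gromov_asymptotic_actE g x y :
  gromov_asymptotic o (a g \o x) (a g \o y) <-> gromov_asymptotic o x y.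
Proof.
split; last exact: gromov_asymptotic_act.
move=> /(gromov_asymptotic_act g^-1%g).
have e z : a g^-1%g \o (a g \o z) = z by apply/funext => n; exact: actK.
by rewrite !e.
Qed.

Lemma bd_act_subproof g (xi : gromov_boundary o) :
  exists2 x, gromov_sequence o x &
    [set a g \o z | z in bd_class xi] =
    [set y | gromov_sequence o y /\ gromov_asymptotic o x y].
Proof.
have [x gx ->] := bd_classP xi; exists (a g \o x).
  exact: gromov_asymptotic_act.
apply/seteqP; split=> [_ [z [gz xz] <-]|y [gy xy]].
  by split; exact: gromov_asymptotic_act.
have e : a g \o (a g^-1%g \o y) = y by apply/funext => n; exact: actVK.
exists (a g^-1%g \o y) => //; split; first exact: gromov_asymptotic_act.
by apply/(gromov_asymptotic_actE g); rewrite e.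
Qed.

Definition bd_act (g : G) (xi : gromov_boundary o) : gromov_boundary o :=
  GromovBoundary (bd_act_subproof g xi).

End action.

Section elementary.
Context {G : groupType}.

Definition generated_semigroup (S : set G) : set G :=
  smallest [set A | forall g h : G, A g -> A h -> A (g * h)%g] S.

Definition cyclic_subgroup (c : G) : set G :=
  [set h | exists n : nat, h = (c ^+ n)%g \/ h = (c ^- n)%g].

(* The subgroup H is covered by finitely many left cosets of one of its cyclic
   subgroups. *)
Definition virtually_cyclic (H : set G) : Prop :=
  exists2 c, H c & exists F : set G, [/\ finite_set F, F `<=` H &
    forall h, H h -> exists2 f, F f & cyclic_subgroup c (f^-1 * h)%g].

Definition non_elementary (H : set G) : Prop := ~ virtually_cyclic H.

End elementary.

Definition discrete_group (G : groupType) : Type := G.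

Section discrete_group.
Variable G : groupType.
HB.instance Definition _ := Group.on (discrete_group G).
HB.instance Definition _ := isPointed.Build (discrete_group G) 1%g.
HB.instance Definition _ := @isMeasurable.Build default_measure_display
  (discrete_group G) (@discrete_measurable G) (@discrete_measurable0 G)
  (@discrete_measurableC G) (@discrete_measurableU G).
End discrete_group.

(* T with its Borel sigma-algebra. The point t0 has no mathematical role: it is
   there because the measurable types of the library must be pointed. *)
Definition borel (T : topologicalType) (t0 : T) : Type := T.

Section borel.
Variables (T : topologicalType) (t0 : T).
HB.instance Definition _ := Topological.on (borel t0).
HB.instance Definition _ := isPointed.Build (borel t0) t0.

Definition borel_display : measure_display := sigma_display (@open T).

HB.instance Definition _ := @isMeasurable.Build borel_display
  (borel t0) <<s @open T >>
  (@sigma_algebra0 _ setT (@open T)) (@sigma_algebraC (borel t0) (@open T))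
  (@sigma_algebra_bigcup _ setT (@open T)).
End borel.

Local Open Scope ereal_scope.

(* The sum of an absolutely summable family ([esum] is only meant for
   nonnegative families). *)
Definition signed_esum (R : realType) (I : choiceType) (f : I -> \bar R) :
    \bar R :=
  \esum_(i in [set: I]) f^\+ i - \esum_(i in [set: I]) f^\- i.

Section measures_on_group.
Context {R : realType} {G : groupType}.
Variable mu : probability (discrete_group G) R.

Definition symmetric_measure : Prop :=
  forall g : G, mu [set g] = mu [set g^-1%g].

Definition measure_support : set G := [set g | mu [set g] != 0].

Definition non_elementary_measure : Prop :=
  non_elementary (generated_semigroup measure_support).

Fixpoint convolution_power (n : nat) : G -> \bar R :=
  if n is m.+1 then
    fun g => \esum_(h in [set: G]) (convolution_power m h * mu [set h^-1 * g]%g)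
  else fun g => if g == 1%g then 1 else 0.

Definition first_moment {X : metricType R} (a : isometric_action G X) (o : X) :
    Prop :=
  \esum_(g in [set: G]) ((mdist (a g o) o)%:E * mu [set g]) < +oo.

Definition stationary {X : metricType R} (a : isometric_action G X) (o : X)
    (xi0 : gromov_boundary o) (nu : probability (borel xi0) R) : Prop :=
  forall A : set (borel xi0), measurable A ->
    \esum_(g in [set: G]) (mu [set g] * pushforward nu (bd_act a g : borel xi0 -> borel xi0) A) = nu A.

End measures_on_group.

Section random_walk.
Context {R : realType} {G : groupType} {d : measure_display}
  {Omega : measurableType d} {P : probability Omega R}.

(* [H i] stands for the increment H_{i+1}. *)
Variable H : nat -> {RV P >-> discrete_group G}.

Definition mutually_independent : Prop :=
  forall (s : seq nat) (A : nat -> set (discrete_group G)), uniq s ->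
    P (\big[setI/setT]_(i <- s) (H i @^-1` A i)) =
    \prod_(i <- s) P (H i @^-1` A i).

Definition iid_of_law (mu : probability (discrete_group G) R) : Prop :=
  (forall i A, distribution P (H i) A = mu A) /\ mutually_independent.

Definition random_walk (n : nat) (w : Omega) : G := (\prod_(i < n) H i w)%g.

End random_walk.

(* Main.v *)
Require Import Defs.
From HB Require Import structures.
From mathcomp Require Import all_boot all_order all_algebra finmap.
From mathcomp Require Import all_classical all_reals all_analysis measurable_realfun.
From mathcomp Require Import ring lra zify.
Import Order.TTheory GRing.Theory Num.Theory.
Import numFieldNormedType.Exports.
Local Open Scope classical_set_scope.
Local Open Scope ring_scope.
Set Implicit Arguments.
Unset Strict Implicit.
Unset Printing Implicit Defensive.

(** The theorem reduces to a contraction property of the random walk on pairs of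
    boundary points: for every [r] and [eps > 0] there is a time [k] such that, for
    all boundary points [z] and [z'], the Gromov product of [X_k z] and [X_k z'] is
    at least [r] with probability at least [1 - eps] ([walk_contraction]).

    Contraction implies equidistribution. Write [X_n = h * y] with [h] of time [k]
    and [n - k >= k]. Then [X_n xi = h (y xi)] is close to [h xi] because [h] is
    independent of [y]; and [X_n^-1 eta = y^-1 (h^-1 eta)], where [y^-1] has the law
    of the walk at time [n - k], since [mu] is symmetric. For a fixed [h], the law
    of [y^-1 (h^-1 eta)] is close to [nu], because a stationary measure is the
    mean of its images under the walk at time [k] and contraction makes the starting
    point irrelevant ([walk_mean_le_integral]); likewise the law of [h xi] is close
    to [nu]. As the boundary is compact ([bd_compact]), a continuous function on
    pairs of boundary points is bounded and uniformly continuous with respect to the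
    Gromov product, which turns closeness into convergence of the means
    ([walk_mean2_le_integral], [walk_mean2_cvg]).

    Contraction follows from a counting argument. If the Gromov product of [g z] and
    [g z'] at [o] is at most [r], then [g^-1 o] lies within bounded distance of the
    line from [z] to [z']. At most linearly many points of the orbit in the ball of
    radius [T] do so, uniformly in [z] and [z'] ([far_count]). By the first moment,
    [X_k o] lies in the ball of radius [L * k] with probability close to one when
    [L] is large, so it suffices that the atoms of [X_k] decay exponentially
    ([walk_decay]).

    Exponential decay is a form of Kesten's theorem. Let [f] be the law of [X_n].
    By symmetry the law of [X_2n] at [g] is the sum of [f x * f (g^-1 x)] over [x].
    If [g] maps the complement of [C] into [C] and [C] carries little of the mass of
    [f ^ 2], this sum is at most a fixed fraction of the sum of [f ^ 2], which is the
    return probability ([conv_double_contract], [conv_decay]). Such sets are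
    shadows: [C] consists of the [x] whose Gromov product with [g] or [g^-1] is at
    least [K], and ten elements [g] whose shadows cover no point more than twice
    suffice.

    These elements come from the action on the boundary ([separated_elements]): in a
    subgroup that is not virtually cyclic there are [g] tending to infinity with
    [g o --> p] and [g^-1 o --> q], and the orbits of [p] and [q] are infinite, so
    that the products [h * g * k^-1] have many directions. The orbits are infinite
    because the stabiliser of a boundary point is virtually cyclic: the Busemann
    function is a quasi-morphism on it with finite fibres ([finite_stab_fibre]), by
    cocompactness and proper discontinuity. *)

(** * Gromov products in a hyperbolic space *)

(** Gromov's four-point condition, with an explicit constant. *)
Definition delta_hyperbolic {R : realType} (X : metricType R) (delta : R) : Prop :=
  forall w x y z : X,
    Num.min (gromov_product w x y) (gromov_product w y z) - delta
      <= gromov_product w x z.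

Section gromov_product.
Context {R : realType} {X : metricType R}.
Implicit Types x y z w : X.

Lemma gromov_productC o x y : gromov_product o x y = gromov_product o y x.
Proof. by rewrite /gromov_product (metric_sym x y) [mdist x o + _]addrC. Qed.

(** The Gromov products at [o] and at [x] of a triangle add up to the side that
    joins [o] to [x]. *)
Lemma gromov_product_base o x y :
  gromov_product o x y + gromov_product x o y = mdist x o.
Proof.
rewrite /gromov_product (metric_sym o x) (metric_sym y x) (metric_sym y o); lra.
Qed.

Lemma gromov_product_le o x y : gromov_product o x y <= mdist x o.
Proof.
rewrite /gromov_product; have := metric_triangle y x o.
rewrite (metric_sym y x); lra.
Qed.

Lemma gromov_product_lip o o' x y :
  gromov_product o x y - mdist o o' <= gromov_product o' x y.
Proof.
rewrite /gromov_product; have := metric_triangle x o' o.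
have := metric_triangle y o' o; rewrite (metric_sym o' o); lra.
Qed.

Lemma gromov_hyperbolicP : gromov_hyperbolic X ->
  exists2 delta : R, 0 <= delta & delta_hyperbolic X delta.
Proof.
move=> [delta hyp]; exists `|delta| => // w x y z.
by apply: le_trans (hyp w x y z); rewrite lerD2l lerN2 ler_norm.
Qed.

Lemma gromov_asymptoticP o (x y : nat -> X) : gromov_asymptotic o x y <->
  forall M, exists N, forall i j, (N <= i)%N -> (N <= j)%N ->
    M <= gromov_product o (x i) (y j).
Proof.
split=> [xy M|xy M].
  have [[A B] /= [[n _ nA] [m _ mB]] AB] := xy M.
  exists (maxn n m) => i j; rewrite !geq_max => /andP[ni mi] /andP[nj mj].
  by apply: (AB (i, j)); split => /=; [exact: nA|exact: mB].
have [N NM] := xy M; exists ([set i | (N <= i)%N], [set i | (N <= i)%N]) => /=.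
  by split; exists N.
by move=> [i j] /= [Ni Nj]; exact: NM.
Qed.

Context (delta : R) (delta_ge0 : 0 <= delta).
Context (hyp : delta_hyperbolic X delta).

Lemma gromov_product_trans o x y z r :
  r <= gromov_product o x y -> r <= gromov_product o y z ->
  r - delta <= gromov_product o x z.
Proof.
move=> rxy ryz; apply: le_trans (hyp o x y z).
by rewrite lerD2r le_min rxy.
Qed.

Lemma four_point x y z w :
  mdist x z + mdist y w <= mdist x y + mdist z w + 2 * delta \/
  mdist x z + mdist y w <= mdist y z + mdist x w + 2 * delta.
Proof.
have := hyp w x y z; rewrite /gromov_product.
by case: (lerP (_ / 2) (_ / 2)) => _ H; [left|right]; lra.
Qed.

(** Two points of the same almost-segment from [x] to [y], at almost the same
    distance of [x], are close. *)
Lemma almost_segment_close x y p q r s :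
  gromov_product p x y <= r -> gromov_product q x y <= r ->
  `|mdist p x - mdist q x| <= s -> mdist p q <= 2 * r + s + 2 * delta.
Proof.
rewrite /gromov_product ler_norml => + + /andP[s1 s2].
have := four_point p x q y.
have := (metric_sym x p, metric_sym x q, metric_sym y p, metric_sym y q).
by move=> [[[-> ->] ->] ->] []; lra.
Qed.

Lemma asymptotic_sym o (x y : nat -> X) :
  gromov_asymptotic o x y -> gromov_asymptotic o y x.
Proof.
move/gromov_asymptoticP => xy; apply/gromov_asymptoticP => M.
have [N xyN] := xy M; exists N => i j Ni Nj.
by rewrite gromov_productC; exact: xyN.
Qed.

Lemma asymptotic_trans o (x y z : nat -> X) :
  gromov_asymptotic o x y -> gromov_asymptotic o y z -> gromov_asymptotic o x z.
Proof.
move/gromov_asymptoticP => xy /gromov_asymptoticP yz.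
apply/gromov_asymptoticP => M.
have [N1 xyN] := xy (M + delta); have [N2 yzN] := yz (M + delta).
exists (maxn N1 N2) => i j; rewrite !geq_max => /andP[i1 i2] /andP[j1 j2].
have -> : M = M + delta - delta by lra.
apply: (@gromov_product_trans _ _ (y (maxn N1 N2))).
  by apply: xyN => //; exact: leq_maxl.
by apply: yzN => //; exact: leq_maxr.
Qed.

(** A lower bound on one far pair of two Gromov sequences holds, up to a
    constant, for all far pairs. *)
Lemma gromov_product_spread o (x y : nat -> X) r :
  gromov_sequence o x -> gromov_sequence o y ->
  exists N, forall i j, (N <= i)%N -> (N <= j)%N ->
    r <= gromov_product o (x i) (y j) ->
    forall i' j', (N <= i')%N -> (N <= j')%N ->
    r - 2 * delta <= gromov_product o (x i') (y j').
Proof.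
move=> /gromov_asymptoticP/(_ r)[N1 xN] /gromov_asymptoticP/(_ r)[N2 yN].
exists (maxn N1 N2) => i j; rewrite !geq_max => /andP[i1 i2] /andP[j1 j2] rij.
move=> i' j'; rewrite !geq_max => /andP[i1' i2'] /andP[j1' j2'].
have -> : r - 2 * delta = (r - delta) - delta by lra.
apply: (@gromov_product_trans _ _ (y j)).
  apply: (@gromov_product_trans _ _ (x i)) => //.
  exact: xN.
by rewrite (le_trans _ (yN j j' j2 j2'))// lerBlDl ler_wpDl.
Qed.

End gromov_product.

(** * The Gromov boundary *)

Section boundary.
Context {R : realType} {X : metricType R} {o : X}.
Local Notation bd := (gromov_boundary o).
Implicit Types (z : bd) (x y : nat -> X).

Lemma bd_class_inj z z' : bd_class z = bd_class z' -> z = z'.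
Proof.
case: z z' => [A PA] [B PB] /= AB; subst B; congr GromovBoundary.
exact: Prop_irrelevance.
Qed.

Lemma bd_class_nonempty z : exists x, bd_class z x.
Proof. by have [x gx ->] := bd_classP z; exists x; split. Qed.

Lemma bd_class_gromov z x : bd_class z x -> gromov_sequence o x.
Proof. by have [x' gx' ->] := bd_classP z => -[]. Qed.

(** The boundary point to which a Gromov sequence converges. *)
Definition bd_lim x (gx : gromov_sequence o x) : bd :=
  GromovBoundary (ex_intro2 _ _ x gx erefl).

Lemma bd_limP x (gx : gromov_sequence o x) : bd_class (bd_lim gx) x.
Proof. by split. Qed.

(** [bd_near r z z'] is the basic entourage of the boundary: the Gromov product
    of [z] and [z'] is at least [r]. *)
Definition bd_near (r : R) z z' : Prop := (r%:E <= bd_gromov_product z z')%E.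

Lemma bd_near_le r r' z z' : r' <= r -> bd_near r z z' -> bd_near r' z z'.
Proof. by move=> r'r; apply: le_trans; rewrite lee_fin. Qed.

(** The Gromov product of boundary points is a supremum of lower limits over all
    representing sequences; up to an additive constant any pair of sequences
    computes it ([bd_nearI], [bd_near_all]). *)
Lemma bd_nearI r z z' x y N : bd_class z x -> bd_class z' y ->
  (forall i j, (N <= i)%N -> (N <= j)%N -> r <= gromov_product o (x i) (y j)) ->
  bd_near r z z'.
Proof.
move=> zx zy rN; rewrite /bd_near /bd_gromov_product.
pose u M := ereal_inf [set (gromov_product o (x i) (y j))%:E
   | i in [set i | (M <= i)%N] & j in [set j | (M <= j)%N]].
apply: (@le_trans _ _ (ereal_sup [set u M | M in [set: nat]])).
  apply: (@le_trans _ _ (u N)); last by apply: ereal_sup_ubound; exists N.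
  apply: le_ereal_inf_tmp => _ [i Ni [j Nj <-]].
  by rewrite lee_fin; exact: rN.
by apply: ereal_sup_ubound; exists x, y.
Qed.

Lemma bd_nearE r z z' : bd_near r z z' ->
  exists x y N, [/\ bd_class z x, bd_class z' y &
    forall i j, (N <= i)%N -> (N <= j)%N -> r - 1 <= gromov_product o (x i) (y j)].
Proof.
move=> rzz'; have : ((r - 1)%:E < bd_gromov_product z z')%E.
  by apply: lt_le_trans rzz'; rewrite lte_fin; lra.
move=> /ereal_sup_gt[_ [x [y [zx zy ->]]]] /ereal_sup_gt[_ [N _ <-]] lt_inf.
exists x, y, N; split=> // i j Ni Nj; rewrite -lee_fin.
apply: le_trans (ltW lt_inf) _; apply: ereal_inf_lbound.
by exists i => //; exists j.
Qed.

Lemma bd_near_sym r z z' : bd_near r z z' -> bd_near (r - 1) z' z.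
Proof.
move=> /bd_nearE[x [y [N [zx zy xyN]]]]; apply: (@bd_nearI _ _ _ y x N) => //.
by move=> i j Ni Nj; rewrite gromov_productC; exact: xyN.
Qed.

Lemma bd_near_refl r z : bd_near r z z.
Proof.
have [x zx] := bd_class_nonempty z.
have /gromov_asymptoticP/(_ r)[N xN] := bd_class_gromov zx.
exact: (@bd_nearI _ _ _ x x N).
Qed.

Context (delta : R) (delta_ge0 : 0 <= delta).
Context (hyp : delta_hyperbolic X delta).

Lemma bd_class_asymptotic z x y : bd_class z x -> bd_class z y ->
  gromov_asymptotic o x y.
Proof.
have [w gw ->] := bd_classP z => -[gx wx] [gy wy].
apply: (asymptotic_trans hyp _ wy); exact: asymptotic_sym.
Qed.

Lemma bd_class_eq z z' x y : bd_class z x -> bd_class z' y ->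
  gromov_asymptotic o x y -> z = z'.
Proof.
move=> zx zy xy; apply: bd_class_inj; apply/seteqP; split => w zw.
  have [v gv E] := bd_classP z'; rewrite E; move: zy; rewrite E => -[gy vy].
  split; first exact: bd_class_gromov zw.
  apply: (asymptotic_trans hyp vy).
  apply: (asymptotic_trans hyp (asymptotic_sym xy)).
  exact: bd_class_asymptotic zx zw.
have [v gv E] := bd_classP z; rewrite E; move: zx; rewrite E => -[gx vx].
split; first exact: bd_class_gromov zw.
apply: (asymptotic_trans hyp vx).
apply: (asymptotic_trans hyp xy).
exact: bd_class_asymptotic zy zw.
Qed.

Lemma bd_near_all r z z' x y : bd_near r z z' -> bd_class z x -> bd_class z' y ->
  exists N, forall i j, (N <= i)%N -> (N <= j)%N ->
    r - 1 - 2 * delta <= gromov_product o (x i) (y j).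
Proof.
move=> /bd_nearE[x' [y' [N [zx' zy' xyN]]]] zx zy.
have /gromov_asymptoticP/(_ (r - 1))[N1 xN] := bd_class_asymptotic zx zx'.
have /gromov_asymptoticP/(_ (r - 1))[N2 yN] := bd_class_asymptotic zy' zy.
pose M := maxn N (maxn N1 N2); exists M => i j.
rewrite !geq_max => /andP[iN /andP[i1 i2]] /andP[jN /andP[j1 j2]].
have MN : (N <= M)%N by rewrite leq_maxl.
have MN1 : (N1 <= M)%N by rewrite leq_max leq_maxl orbT.
have MN2 : (N2 <= M)%N by rewrite leq_max leq_maxr orbT.
have -> : r - 1 - 2 * delta = r - 1 - delta - delta by lra.
apply: (@gromov_product_trans _ _ _ hyp _ _ (y' M)).
  apply: (@gromov_product_trans _ _ _ hyp _ _ (x' M)); first exact: xN.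
  exact: xyN.
by rewrite (le_trans _ (yN _ _ _ _))// lerBlDl ler_wpDl.
Qed.

(** The loss in the ultrametric inequality on the boundary. *)
Local Notation loss := (1 + 3 * delta).

Lemma bd_near_trans r z1 z2 z3 : bd_near r z1 z2 -> bd_near r z2 z3 ->
  bd_near (r - loss) z1 z3.
Proof.
move=> n12 n23.
have [x1 zx1] := bd_class_nonempty z1.
have [x2 zx2] := bd_class_nonempty z2.
have [x3 zx3] := bd_class_nonempty z3.
have [N1 H1] := bd_near_all n12 zx1 zx2.
have [N2 H2] := bd_near_all n23 zx2 zx3.
apply: (@bd_nearI _ _ _ x1 x3 (maxn N1 N2)) => // i j.
rewrite !geq_max => /andP[i1 i2] /andP[j1 j2].
have -> : r - loss = r - 1 - 2 * delta - delta by lra.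
apply: (@gromov_product_trans _ _ _ hyp _ _ (x2 (maxn N1 N2))).
  by apply: H1 => //; exact: leq_maxl.
by apply: H2 => //; exact: leq_maxr.
Qed.

(** Two boundary points that are not close have bounded Gromov products along all
    the sequences that represent them. *)
Lemma bd_far r z z' x y : ~ bd_near r z z' -> bd_class z x -> bd_class z' y ->
  exists N, forall i j, (N <= i)%N -> (N <= j)%N ->
    gromov_product o (x i) (y j) <= r + 2 * delta.
Proof.
move=> nzz' zx zy.
have [N H] := gromov_product_spread delta_ge0 hyp (r + 2 * delta)
  (bd_class_gromov zx) (bd_class_gromov zy).
exists N => i j Ni Nj; apply/ltW; rewrite ltNge; apply/negP => rij.
apply: nzz'; apply: (@bd_nearI _ _ _ x y N) => // i' j' Ni' Nj'.
have -> : r = r + 2 * delta - 2 * delta by lra.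
exact: H rij _ _ _ _.
Qed.

(** The interior of the set of the [z'] with [bd_near r z z']: a Borel substitute for
    this set, which need be neither open nor closed. *)
Definition bd_ball r z : set bd :=
  [set z' | exists s, forall z'', bd_near s z' z'' -> bd_near r z z''].

Lemma bd_ball_sub r z z' : bd_ball r z z' -> bd_near r z z'.
Proof. by move=> [s]; apply; exact: bd_near_refl. Qed.

Lemma bd_ball_near r z z' : bd_near (r + loss) z z' -> bd_ball r z z'.
Proof.
move=> zz'; exists (r + loss) => z'' /(bd_near_trans zz').
by apply: bd_near_le; lra.
Qed.

Lemma bd_openP (U : set bd) : open U <->
  forall z, U z -> exists r, forall z', bd_near r z z' -> U z'.
Proof.
split=> [oU|oU]; first by change (bd_open U) in oU => z /oU[r rU]; exists r.
by change (bd_open U) => z /oU[r rU]; exists r.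
Qed.

Lemma open_bd_ball r z : open (bd_ball r z).
Proof.
apply/bd_openP => z' [s sr]; exists (s + loss) => z'' z'z''.
exists (s + loss) => z3 /(bd_near_trans z'z'') n3.
by apply: sr; apply: bd_near_le n3; lra.
Qed.

Lemma nbhs_bd_near r z : nbhs z (bd_near r z).
Proof.
rewrite nbhsE; exists (bd_ball r z); last by move=> z' /bd_ball_sub.
split; first exact: open_bd_ball.
by apply: bd_ball_near; exact: bd_near_refl.
Qed.

Lemma nbhs_bdP z (A : set bd) : nbhs z A <-> exists r, bd_near r z `<=` A.
Proof.
split=> [|[r rA]]; last by apply: filterS rA _; exact: nbhs_bd_near.
rewrite nbhsE => -[U [/bd_openP oU Uz] UA].
by have [r rU] := oU _ Uz; exists r => z' /rU/UA.
Qed.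

End boundary.

Section boundary_action.
Context {R : realType} {G : groupType} {X : metricType R}.
Context (a : isometric_action G X) {o : X}.
Local Notation bd := (gromov_boundary o).
Implicit Types (z : bd) (g h : G).

(** The displacement of the base point. *)
Definition displ g : R := mdist (a g o) o.

Lemma displ_ge0 g : 0 <= displ g.
Proof. exact: mdist_ge0. Qed.

Lemma displV g : displ g^-1%g = displ g.
Proof.
by rewrite /displ -(act_isometry a g (a g^-1%g o) o) (actVK a g) metric_sym.
Qed.

Lemma displM g h : displ (g * h)%g <= displ g + displ h.
Proof.
rewrite /displ actM -[mdist (a h o) o](act_isometry a g) addrC.
exact: metric_triangle.
Qed.

Lemma displ1 : displ 1%g = 0.
Proof. by rewrite /displ act1 mdistxx. Qed.

Lemma gromov_product_act g o' x y :
  gromov_product (a g o') (a g x) (a g y) = gromov_product o' x y.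
Proof. by rewrite /gromov_product !act_isometry. Qed.

Lemma gromov_product_actV g x y :
  gromov_product o (a g x) (a g y) = gromov_product (a g^-1%g o) x y.
Proof. by rewrite -[RHS](gromov_product_act g) (actVK a g). Qed.

Lemma bd_act_class g z x : bd_class z x -> bd_class (bd_act a g z) (a g \o x).
Proof. by move=> zx; exists x. Qed.

Lemma bd_actM g h z : bd_act a (g * h)%g z = bd_act a g (bd_act a h z).
Proof.
apply: bd_class_inj; apply/seteqP; split => [_ [x zx <-]|_ [_ [x zx <-] <-]].
  exists (a h \o x); first by exists x.
  by apply/funext => n /=; rewrite actM.
by exists x => //; apply/funext => n /=; rewrite actM.
Qed.

Lemma bd_act1 z : bd_act a 1%g z = z.
Proof.
have e (x : nat -> X) : a 1%g \o x = x by apply/funext => n /=; rewrite act1.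
apply: bd_class_inj; apply/seteqP; split => [_ [x zx <-]|x zx].
  by rewrite e.
by exists x.
Qed.

Lemma bd_actK g : cancel (bd_act a g : bd -> bd) (bd_act a g^-1%g).
Proof. by move=> z; rewrite -bd_actM mulVg bd_act1. Qed.

Lemma bd_near_act r g z z' : bd_near r z z' ->
  bd_near (r - 1 - displ g) (bd_act a g z) (bd_act a g z').
Proof.
move=> /bd_nearE[x [y [N [zx zy xyN]]]].
apply: (@bd_nearI _ _ _ _ _ _ (a g \o x) (a g \o y) N); try exact: bd_act_class.
move=> i j Ni Nj /=; rewrite gromov_product_actV -displV.
have := gromov_product_lip o (a g^-1%g o) (x i) (y j).
by have := xyN _ _ Ni Nj; rewrite /displ (metric_sym o); lra.
Qed.

Lemma bd_act_continuous (delta : R) (delta_ge0 : 0 <= delta)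
    (hyp : delta_hyperbolic X delta) g :
  continuous (bd_act a g : bd -> bd).
Proof.
move=> z A /(nbhs_bdP delta_ge0 hyp)[r rA].
apply/(nbhs_bdP delta_ge0 hyp); exists (r + 1 + displ g) => z' zz' /=.
by apply: rA; apply: bd_near_le (bd_near_act g zz'); lra.
Qed.

End boundary_action.
Arguments displ {R G X} a o g.

(** * Directions at infinity and compactness of the boundary *)

Section directions.
Context {R : realType} {X : metricType R}.

Lemma rough_point : roughly_geodesic X ->
  exists2 C : R, 0 <= C & forall (x y : X) t, 0 <= t <= mdist x y -> exists z,
    `|mdist x z - t| <= C /\ `|mdist z y - (mdist x y - t)| <= C.
Proof.
move=> [C roughX]; exists (2 * `|C|); first by rewrite mulr_ge0.
move=> x y t /andP[t0 ty]; have [T [p [T0 p0 pT pd]]] := roughX x y.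
pose s := Num.min t T.
have sT : 0 <= s <= T by rewrite le_min t0 T0 ge_min lexx orbT.
exists (p s); rewrite -p0 -pT in ty *.
have CC : C <= `|C| := ler_norm C.
have := pd 0 T; have := pd 0 s; have := pd s T.
rewrite lexx T0 lexx => /(_ sT isT)/andP[d1 d2] /(_ isT sT)/andP[d3 d4].
move=> /(_ isT isT)/andP[d5 d6]; move: d1 d2 d3 d4 d5 d6.
rewrite !sub0r !normrN (ger0_norm T0); case/andP: sT => s0 sT.
rewrite (ger0_norm s0) distrC (ger0_norm (_ : 0 <= T - s)) ?subr_ge0//.
rewrite !ler_norml; move: sT s0; rewrite /s.
by case: (lerP t T) => ? *; split; apply/andP; split; lra.
Qed.

Context (o : X) (delta : R) (delta_ge0 : 0 <= delta).
Context (hyp : delta_hyperbolic X delta).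

(** In a proper roughly geodesic space, far points seen from [o] have finitely
    many directions up to a bounded error, because the sphere of radius [r] is
    covered by finitely many balls. In terms of an ultrafilter, almost all of them
    have the same direction. *)
Lemma ultra_direction : proper_space X -> roughly_geodesic X ->
  exists2 c : R, 0 <= c & forall (r : R) (I : Type) (U : set_system I) (u : I -> X),
    UltraFilter U -> 0 <= r -> U [set i | r <= mdist (u i) o] ->
    exists2 A, U A & forall i j, A i -> A j ->
      r - c <= gromov_product o (u i) (u j).
Proof.
move=> properX /rough_point[C C0 roughX].
exists (C + 1 + delta); first by rewrite !addr_ge0.
move=> r I U u UU r0 Ur.
have /choice[z zP] : forall i, exists z, r <= mdist (u i) o ->
    `|mdist o z - r| <= C /\ `|mdist z (u i) - (mdist o (u i) - r)| <= C.
  move=> i; case: (lerP r (mdist (u i) o)) => [ri|_]; last by exists o.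
  have [|z zr] := roughX o (u i) r; first by rewrite r0 metric_sym.
  by exists z.
pose K := [set y | mdist o y <= r + C].
have zK : U [set i | mdist o (z i) <= r + C].
  by apply: filterS Ur => i /= /zP[+ _]; rewrite ler_norml; lra.
have [p [_ clp]] := properX o (r + C) (z @ U) _ zK.
have Up : U [set i | mdist p (z i) < 1].
  case: (in_ultra_setVsetC [set i | mdist p (z i) < 1] UU) => // Un.
  have Un' : (z @ U) (~` ball p 1).
    change (U (z @^-1` (~` ball p 1))).
    by apply: filterS Un => i /=; rewrite ballEmdist.
  by have [q []] := clp _ (ball p 1) Un' (nbhsx_ballx p 1 ltr01).
exists ([set i | r <= mdist (u i) o] `&` [set i | mdist p (z i) < 1]).
  exact: filterI.
have dir i : r <= mdist (u i) o -> mdist p (z i) < 1 ->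
    r - C - 1 <= gromov_product o (u i) p.
  move=> ri p1; have [] := zP _ ri; rewrite !ler_norml /gromov_product.
  have := metric_triangle p (z i) (u i); have := metric_triangle o p (z i).
  by rewrite !(metric_sym o) !(metric_sym _ (u i)); lra.
move=> i j [/= ri pi] [/= rj pj].
have -> : r - (C + 1 + delta) = r - C - 1 - delta by lra.
apply: (@gromov_product_trans _ _ _ hyp _ _ p); first exact: dir.
by rewrite gromov_productC; exact: dir.
Qed.

Lemma filter_seq (I : Type) (F : set_system I) (A : nat -> set I) : Filter F ->
  (forall n, F (A n)) -> forall n, F [set i | forall q, (q <= n)%N -> A q i].
Proof.
move=> FF FA; elim=> [|n IHn].
  by apply: filterS (FA 0%N) => i A0 q; rewrite leqn0 => /eqP ->.
apply: filterS2 IHn (FA n.+1) => i An An1 q.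
by rewrite leq_eqVlt => /orP[/eqP ->//|]; exact: An.
Qed.

Lemma exists_nat_ge (r : R) : exists n : nat, r <= n%:R.
Proof.
exists (Num.truncn `|r|).+1; rewrite (le_trans (ler_norm r))// ltW//.
by have := real_truncnS_gt (num_real `|r|).
Qed.

(** An ultrafilter on the boundary has, for every [n], a member [A n] whose points
    are pairwise close at level [n]; points picked in the finite intersections of
    these members converge to the limit. *)
Lemma bd_compact : proper_space X -> roughly_geodesic X ->
  compact [set: gromov_boundary o].
Proof.
have d0 := delta_ge0.
move=> properX roughX; have [c c0 dirX] := ultra_direction properX roughX.
rewrite compact_ultra => F FU _.
have /choice[rep repP] := @bd_class_nonempty R X o.
have /choice[N NP] : forall zn : gromov_boundary o * nat, exists N,
    forall i j, (N <= i)%N -> (N <= j)%N ->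
    zn.2%:R <= gromov_product o (rep zn.1 i) (rep zn.1 j).
  move=> [z n] /=.
  by have /gromov_asymptoticP/(_ n%:R) := bd_class_gromov (repP z).
(* [u n z] is a point of the space that represents [z] at level [n]. *)
pose u n z := rep z (N (z, n)).
have uP n z i : (N (z, n) <= i)%N -> n%:R <= gromov_product o (u n z) (rep z i).
  by move=> Ni; apply: (NP (z, n)).
have uu m n z : (m <= n)%N -> m%:R <= gromov_product o (u m z) (u n z).
  move=> mn; case: (leqP (N (z, m)) (N (z, n))) => [|/ltnW] Nmn; first exact: uP.
  rewrite gromov_productC; apply: le_trans (uP _ _ _ Nmn).
  by rewrite ler_nat.
have /choice[A AP] : forall n, exists A, F A /\ forall z z', A z -> A z' ->
    n%:R - c <= gromov_product o (u n z) (u n z').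
  move=> n; have [//||A FA An] := dirX n%:R _ F (u n) FU; last by exists A.
  apply: filterE => z /=; apply: le_trans (gromov_product_le _ _ (rep z (N (z, n)))).
  exact: uP.
have FA n : F [set z | forall q, (q <= n)%N -> A q z].
  by apply: filter_seq => q; exact: (AP q).1.
have /choice[w wP] : forall n, exists z, forall q, (q <= n)%N -> A q z.
  by move=> n; have [z] := filter_ex (FA n); exists z.
pose x n := u n (w n).
have xx m n : (m <= n)%N -> m%:R - c - delta <= gromov_product o (x m) (x n).
  move=> mn; apply: (@gromov_product_trans _ _ _ hyp _ _ (u m (w n))).
    by apply: (AP m).2; apply: wP.
  by apply: le_trans (uu _ _ _ mn); rewrite gerBl.
have gx : gromov_sequence o x.
  apply/gromov_asymptoticP => M; have [n nM] := exists_nat_ge (M + c + delta).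
  exists n => i j ni nj; wlog ij : i j ni nj / (i <= j)%N => [H|].
    by case/orP: (leq_total i j) => ?; [|rewrite gromov_productC]; exact: H.
  apply: le_trans (xx _ _ ij); move: ni; rewrite -(ler_nat R); lra.
exists (bd_lim gx); split=> // B /(nbhs_bdP delta_ge0 hyp)[r rB].
have [n nM] := exists_nat_ge (r + c + 3 * delta).
apply: filterS (FA n) => z zA; apply: rB.
apply: (@bd_nearI _ _ _ _ _ _ x (rep z) (maxn n (N (z, n)))) => // i j.
rewrite !geq_max => /andP[ni _] /andP[_ nj].
apply: le_trans (_ : n%:R - c - delta - delta - delta <= _); first by lra.
apply: (@gromov_product_trans _ _ _ hyp _ _ (u n z)).
  apply: (@gromov_product_trans _ _ _ hyp _ _ (x n)).
    by rewrite gromov_productC; exact: xx.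
  apply: le_trans ((AP n).2 _ _ _ _); rewrite ?gerBl//.
    exact: wP.
  exact: zA.
by apply: (@le_trans _ _ n%:R); [lra|exact: uP].
Qed.

(** The points where [Phi] oscillates by more than [e] at level [n] would otherwise
    have a cluster point as [n] tends to infinity. *)
Lemma bd_unif_continuous (Phi : gromov_boundary o * gromov_boundary o -> R) :
  compact [set: gromov_boundary o] -> continuous Phi ->
  forall e, 0 < e -> exists r, forall z z' w w',
    bd_near r z z' -> bd_near r w w' -> `|Phi (z, w) - Phi (z', w')| <= e.
Proof.
have d0 := delta_ge0.
move=> cptX ctsPhi e e0; apply: contrapT => noR.
pose S (n : nat) : set (gromov_boundary o * gromov_boundary o) :=
  [set p | exists z' w', [/\ bd_near n%:R p.1 z', bd_near n%:R p.2 w' &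
     e < `|Phi p - Phi (z', w')|]].
have S0 n : S n !=set0.
  apply: contrapT => nS; apply: noR; exists n%:R => z z' w w' zz' ww'.
  rewrite leNgt; apply/negP => eP; apply: nS; exists (z, w).
  by exists z', w'.
have SI i j : exists k, S k `<=` S i `&` S j.
  have le_near m n p z' : (m <= n)%N -> bd_near n%:R p z' -> bd_near m%:R p z'.
    by move=> mn; apply: bd_near_le; rewrite ler_nat.
  exists (maxn i j) => p [z' [w' [pz pw eP]]]; split; exists z', w'; split=> //.
  - exact: le_near (leq_maxl i j) pz.
  - exact: le_near (leq_maxl i j) pw.
  - exact: le_near (leq_maxr i j) pz.
  - exact: le_near (leq_maxr i j) pw.
have FF : ProperFilter (filter_from [set: nat] S).
  apply: filter_from_proper; last by move=> n _; exact: S0.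
  apply: filter_from_filter; first by exists 0%N.
  by move=> i j _ _; have [k] := SI i j; exists k.
have [|p [_ clp]] := compact_setX cptX cptX FF _.
  by exists 0%N => // q _.
have e2 : 0 < e / 2 by rewrite divr_gt0.
have : nbhs p [set q | `|Phi p - Phi q| < e / 2].
  by have /cvgr_dist_lt := ctsPhi p; apply.
case=> -[V W] /= [/(nbhs_bdP delta_ge0 hyp)[s1 sV]].
move=> /(nbhs_bdP delta_ge0 hyp)[s2 sW] VW.
pose s := Num.max s1 s2 + (1 + 3 * delta).
have sV' z : bd_near (s - (1 + 3 * delta)) p.1 z -> V z.
  by move=> n1; apply: sV; apply: bd_near_le n1; rewrite addrK le_max lexx.
have sW' z : bd_near (s - (1 + 3 * delta)) p.2 z -> W z.
  by move=> n1; apply: sW; apply: bd_near_le n1; rewrite addrK le_max lexx orbT.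
have [n ns] := exists_nat_ge s.
have [||q [[z' [w' [qz qw eP]]] [q1 q2]]] :=
    clp (S n) (bd_near s p.1 `*` bd_near s p.2).
- by exists n.
- by exists (bd_near s p.1, bd_near s p.2) => //; split;
    exact: nbhs_bd_near delta_ge0 hyp _ _.
have H1 : `|Phi p - Phi q| < e / 2.
  apply: (VW q); split; [apply: sV'|apply: sW'].
    by apply: bd_near_le q1; lra.
  by apply: bd_near_le q2; lra.
have H2 : `|Phi p - Phi (z', w')| < e / 2.
  apply: (VW (_, _)); split; [apply: sV'|apply: sW'] => /=.
    by apply: (bd_near_trans delta_ge0 hyp) q1 _; apply: bd_near_le qz.
  by apply: (bd_near_trans delta_ge0 hyp) q2 _; apply: bd_near_le qw.
have : `|Phi q - Phi (z', w')| < e.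
  have -> : Phi q - Phi (z', w') = (Phi p - Phi (z', w')) - (Phi p - Phi q) by lra.
  by apply: le_lt_trans (ler_normB _ _) _; lra.
by rewrite ltNge (ltW eP).
Qed.

Lemma bd_bounded (Phi : gromov_boundary o * gromov_boundary o -> R) :
  compact [set: gromov_boundary o] -> continuous Phi ->
  exists2 B, 0 <= B & forall p, `|Phi p| <= B.
Proof.
move=> cptX ctsPhi.
have /compact_bounded[M [_ MB]] : compact (range Phi).
  apply: continuous_compact; last by rewrite -setXTT; exact: compact_setX.
  exact: continuous_subspaceT.
exists (`|M| + 1); first by rewrite addr_ge0.
move=> p; apply: MB; last by exists p.
by rewrite (le_lt_trans (ler_norm M))// ltrDl.
Qed.

End directions.

(** * Stabilisers of boundary points *)

Lemma compact_bounded_mdist (R : realType) (X : metricType R) (o : X) (K : set X) :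
  compact K -> exists D, forall k, K k -> mdist o k <= D.
Proof.
move=> cK; apply: contrapT => nD.
pose S (n : nat) := [set k | K k /\ n%:R < mdist o k].
have S0 n : S n !=set0.
  apply: contrapT => nS; apply: nD; exists n%:R => k Kk; rewrite leNgt.
  by apply/negP => nk; apply: nS; exists k.
have FF : ProperFilter (filter_from [set: nat] S).
  apply: filter_from_proper => //; apply: filter_from_filter; first by exists 0%N.
  move=> i j _ _; exists (maxn i j) => // k [Kk /= mk]; split; split=> //.
    by apply: le_lt_trans mk; rewrite ler_nat leq_maxl.
  by apply: le_lt_trans mk; rewrite ler_nat leq_maxr.
have [|p [_ clp]] := cK _ FF; first by exists 0%N => // k [].
have [n np] := exists_nat_ge (mdist o p + 1).
have [||k [[_ nk] pk]] := clp (S n) (ball p 1); first by exists n.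
  exact: (nbhsx_ballx p 1 ltr01).
move: pk; rewrite ballEmdist /= => pk.
by have := metric_triangle o p k; lra.
Qed.

Lemma finite_common_nat (T : choiceType) (F : set T) (P : T -> nat -> Prop) :
  finite_set F -> (forall t, F t -> exists N, forall n, (N <= n)%N -> P t n) ->
  exists N, forall n, (N <= n)%N -> forall t, F t -> P t n.
Proof.
move=> /finite_fsetP[A ->] PA.
have /choice[N NP] : forall t, exists N, t \in A -> forall n, (N <= n)%N -> P t n.
  move=> t; case: (boolP (t \in A)) => [tA|_]; last by exists 0%N.
  by have [N] := PA t tA; exists N.
exists (\max_(t <- A) N t) => n Nn t tA; apply: NP => //.
by apply: leq_trans Nn; exact: leq_bigmax_seq.
Qed.

Section stabiliser.
Context {R : realType} {G : groupType} {X : metricType R}.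
Context (a : isometric_action G X) (o : X) (delta : R) (delta_ge0 : 0 <= delta).
Context (hyp : delta_hyperbolic X delta).
Context (properX : proper_space X) (roughX : roughly_geodesic X).
Context (geoa : geometric_action a).

Lemma finite_displ r : finite_set [set g | displ a o g <= r].
Proof.
have [pda _] := geoa.
have cK : compact [set y | mdist o y <= `|r|] by exact: properX.
apply: sub_finite_set (pda _ cK) => g /= gr.
exists (a g o); split; last first.
  by rewrite /= metric_sym; exact: le_trans gr (ler_norm r).
by exists o => //=; rewrite mdistxx.
Qed.

(** The differences of distances to a point tending to a boundary point converge up
    to a bounded error. *)
Lemma busemann_close (x y : nat -> X) u v : gromov_asymptotic o x y ->
  exists N, forall i j, (N <= i)%N -> (N <= j)%N ->
    mdist u (x i) - mdist v (x i) <= mdist u (y j) - mdist v (y j) + 2 * delta.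
Proof.
move/gromov_asymptoticP/(_ (mdist u o + mdist v o)) => [N xyN].
exists N => i j Ni Nj; have := xyN i j Ni Nj; rewrite /gromov_product.
have := metric_triangle (x i) v o; have := metric_triangle (y j) u o.
have := metric_triangle u o v; rewrite (metric_sym (x i) v) (metric_sym (y j) u).
by have := four_point hyp u v (x i) (y j); rewrite (metric_sym o v); lra.
Qed.

Context (z : gromov_boundary o) (x : nat -> X) (zx : bd_class z x).

(** The Busemann function of [z], read on the orbit of [o]. *)
Lemma busemann_exists : exists beta : G -> R, forall g, exists N, forall n,
  (N <= n)%N -> `|mdist (a g o) (x n) - mdist o (x n) - beta g| <= 2 * delta.
Proof.
suff /choice[beta bP] : forall g, exists b, exists N, forall n, (N <= n)%N ->
    `|mdist (a g o) (x n) - mdist o (x n) - b| <= 2 * delta by exists beta.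
move=> g; have [N H] := busemann_close (a g o) o (bd_class_gromov zx).
exists (mdist (a g o) (x N) - mdist o (x N)); exists N => n Nn.
have := H _ _ Nn (leqnn N); have := H _ _ (leqnn N) Nn.
by rewrite ler_norml => ? ?; apply/andP; split; lra.
Qed.

Lemma stab_asymptotic g : bd_act a g z = z -> gromov_asymptotic o (a g \o x) x.
Proof.
move=> gz; apply: (bd_class_asymptotic hyp (z := z)) => //.
by rewrite -[X in bd_class X]gz; exact: bd_act_class.
Qed.

Context (beta : G -> R) (betaP : forall g, exists N, forall n,
  (N <= n)%N -> `|mdist (a g o) (x n) - mdist o (x n) - beta g| <= 2 * delta).

Lemma busemann_quasimorphism g h : bd_act a g z = z ->
  `|beta (g * h)%g - beta g - beta h| <= 8 * delta.
Proof.
move=> gz; have agx := stab_asymptotic gz.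
have [N1 H1] := busemann_close (a (g * h)%g o) (a g o) agx.
have [N2 H2] := busemann_close (a (g * h)%g o) (a g o) (asymptotic_sym agx).
have [N3 H3] := betaP g; have [N4 H4] := betaP h.
have [N5 H5] := betaP (g * h)%g.
pose n := maxn N1 (maxn N2 (maxn N3 (maxn N4 N5))).
have := leqnn n; rewrite {1}/n !geq_max => /and5P[n1 n2 n3 n4 n5].
have := H1 _ _ n1 n1; have := H2 _ _ n2 n2; have := H3 _ n3; have := H4 _ n4.
have := H5 _ n5; rewrite /= actM !act_isometry !ler_norml.
move=> /andP[? ?] /andP[? ?] /andP[? ?] ? ?.
by apply/andP; split; lra.
Qed.

(** Far on the way to [z] there are points moved by a bounded amount by all the
    elements of a given finite part of the stabiliser of [z] on which [beta] is
    small. *)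
Lemma stab_almost_fixed C : exists D, forall F : set G, finite_set F ->
  (forall g, F g -> bd_act a g z = z /\ `|beta g| <= C) ->
  exists y, forall g, F g -> mdist y (a g y) <= D.
Proof.
have d0 := delta_ge0; have [C0 C00 rough] := rough_point roughX.
pose E := 3 * C0 + 2 * delta.
exists (2 * E + C0 + `|C| + 6 * delta) => F finF FP.
(* [y] is chosen at distance about [t] of [o] on the way to [z], beyond the
   displacements of all the elements of [F]. *)
have [t [t0 tF]] : exists t, 0 <= t /\ forall g, F g -> displ a o g <= t.
  have /finite_fsetP[A FA] := finF.
  exists (\sum_(g <- A) displ a o g); split.
    by apply: sumr_ge0 => g _; exact: displ_ge0.
  move=> g; rewrite FA /= => gA; rewrite (big_fsetD1 g)//= lerDl.
  by apply: sumr_ge0 => h _; exact: displ_ge0.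
have /gromov_asymptoticP/(_ t)[n xn] := bd_class_gromov zx.
have tn : 0 <= t <= mdist o (x n).
  rewrite t0 metric_sym; apply: le_trans (gromov_product_le o (x n) (x n)).
  exact: xn.
have [y []] := rough o (x n) t tn; rewrite !ler_norml => /andP[y1 y2] /andP[y3 y4].
have yx m : (n <= m)%N -> mdist y (x m) - mdist o (x m) <= E - t.
  move=> nm; have : t - C0 - delta <= gromov_product o y (x m).
    apply: (gromov_product_trans hyp (y := x n)).
      by rewrite /gromov_product (metric_sym _ o) (metric_sym _ o); lra.
    by have := xn n m (leqnn n) nm; lra.
  by rewrite /gromov_product (metric_sym y o) (metric_sym (x m) o) /E; lra.
exists y => g Fg; have [gz bg] := FP g Fg.
have agx := stab_asymptotic gz.
have [N1 H1] := busemann_close (a g y) (a g o) (asymptotic_sym agx).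
have [N2 H2] := betaP g.
pose m := maxn n (maxn N1 N2).
have := leqnn m; rewrite {1}/m !geq_max => /and3P[mn m1 m2].
have := yx m mn; have := H1 m m m1 m1; have := H2 m m2.
rewrite /= !act_isometry => b1 b2 b3.
have := tF g Fg; rewrite /displ (metric_sym _ o) => gt.
have := ler_norm C => CC.
move: b1 bg; rewrite !ler_norml => /andP[b4 b5] /andP[b6 b7].
have E0 : 0 <= E by rewrite /E; lra.
(* [y] and [a g y] are both at distance about [t] of [o] on the way to [x m]. *)
have h1 : mdist o (a g y) <= t + (E + C0 + `|C| + 4 * delta).
  have := four_point hyp o (a g o) (a g y) (x m); rewrite act_isometry.
  by have ? := normr_ge0 C; case=> ?; lra.
have := four_point hyp y o (a g y) (x m); rewrite (metric_sym y o).
by case=> ?; lra.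
Qed.

(** Cocompactness brings these points back near [o] by one conjugation. *)
Lemma finite_stab_fibre C :
  finite_set [set g | bd_act a g z = z /\ `|beta g| <= C].
Proof.
have [_ [K cK KT]] := geoa.
have [D1 KD1] := compact_bounded_mdist o cK.
have [D2 FD2] := stab_almost_fixed C.
have finB := finite_displ (D2 + 2 * D1).
apply: contrapT => infS.
have /finite_fsetP[B BE] := finB.
have [F FS cardF] := infinite_set_fset (#|` B|).+1 infS.
have [y yF] := FD2 [set` F] (finite_fset F) FS.
have [h _ [k Kk hk]] : (\bigcup_g (a g @` K)) y by rewrite KT.
have : (#|` [fset (h^-1 * g * h)%g | g in F]%fset| <= #|` B|)%N.
  apply: fsubset_leq_card; apply/fsubsetP => _ /imfsetP[g /= gF ->].
  have : [set g | displ a o g <= D2 + 2 * D1] (h^-1 * g * h)%g; last by rewrite BE.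
  rewrite /= /displ -(act_isometry a h) -actM !mulgA mulgV mul1g actM.
  have := yF g gF; have := KD1 k Kk; rewrite -hk.
  have := metric_triangle (a g (a h o)) (a g (a h k)) (a h o).
  have := metric_triangle (a g (a h k)) (a h k) (a h o).
  rewrite !act_isometry (metric_sym k o) (metric_sym (a g _) (a h k)); lra.
rewrite card_imfset//=; first by move=> /(leq_trans cardF); rewrite ltnn.
by move=> g1 g2 /mulIg /mulgI.
Qed.

End stabiliser.

(** * Elements with separated directions in a non-elementary subgroup *)

Section subgroups.
Context {G : groupType}.
Implicit Types (H : set G) (c f g h : G).

(** [H] is (the underlying set of) a subgroup of the possibly infinite group [G]. *)
Definition is_subgroup H : Prop :=
  [/\ H 1%g, (forall g h, H g -> H h -> H (g * h)%g) &
      (forall g, H g -> H g^-1%g)].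

Lemma cyclic_subgroup1 c : cyclic_subgroup c 1%g.
Proof. by exists 0%N; left; rewrite expg0. Qed.

Lemma cyclic_subgroupM c h : cyclic_subgroup c h -> cyclic_subgroup c (h * c)%g.
Proof.
move=> [n [->|->]]; first by exists n.+1; left; rewrite expgSr.
case: n => [|n]; first by exists 1%N; left; rewrite expg0 invg1 mul1g expg1.
by exists n; right; rewrite expgS invgM mulgVK.
Qed.

Lemma cyclic_subgroupMV c h :
  cyclic_subgroup c h -> cyclic_subgroup c (h * c^-1)%g.
Proof.
move=> [n [->|->]]; last by exists n.+1; right; rewrite expgS invgM.
case: n => [|n]; first by exists 1%N; right; rewrite expg0 mul1g expg1.
by exists n; left; rewrite expgSr mulgK.
Qed.

(** Virtual cyclicity passes to a group from a subset of which finitely many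
    translates cover it. *)
Lemma virtually_cyclic_extend H H' F : H' `<=` H -> F `<=` H ->
  (forall g h, H g -> H h -> H (g * h)%g) ->
  finite_set F -> (forall h, H h -> exists2 f, F f & H' (f^-1 * h)%g) ->
  virtually_cyclic H' -> virtually_cyclic H.
Proof.
move=> H'H FH HM finF HF [c H'c [F' [finF' F'H' cycF']]].
exists c; first exact: H'H.
exists [set (f * f')%g | f in F & f' in F']; split.
- exact: finite_image2.
- by move=> _ [f Ff [f' Ff' <-]]; apply: HM; [exact: FH|apply/H'H/F'H'].
move=> h /HF[f Ff /cycF'[f' Ff' cyc]].
by exists (f * f')%g; [exists f => //; exists f'|rewrite invgM -mulgA].
Qed.

Lemma virtually_cyclic_finite H : H 1%g -> finite_set H -> virtually_cyclic H.
Proof.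
move=> H1 finH; exists 1%g => //; exists H; split=> // h Hh.
by exists h => //; rewrite mulVg; exact: cyclic_subgroup1.
Qed.

(** A quasi-morphism with finite fibres makes the group virtually cyclic. *)
Lemma quasimorphism_virtually_cyclic (R : realType) H (beta : G -> R) D :
  is_subgroup H ->
  (forall g h, H g -> H h -> `|beta (g * h)%g - beta g - beta h| <= D) ->
  (forall C, finite_set [set g | H g /\ `|beta g| <= C]) ->
  virtually_cyclic H.
Proof.
move=> [H1 HM HV] qm fib.
have D0 : 0 <= D by apply: le_trans (qm _ _ H1 H1).
have b1 : `|beta 1%g| <= D.
  by have := qm _ _ H1 H1; rewrite mul1g !ler_norml => /andP[? ?]; lra.
have bV g : H g -> `|beta g^-1%g + beta g| <= 2 * D.
  move=> Hg; have := qm _ _ (HV _ Hg) Hg; rewrite mulVg; move: b1.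
  by rewrite !ler_norml => /andP[? ?] /andP[? ?]; lra.
have [[c Hc bc]|nc] := pselect (exists2 c, H c & 3 * D + 1 < beta c); last first.
  apply: virtually_cyclic_finite => //.
  apply: sub_finite_set (fib (5 * D + 1)) => g Hg; split=> //.
  have up h : H h -> beta h <= 3 * D + 1.
    by move=> Hh; rewrite leNgt; apply/negP => ?; apply: nc; exists h.
  have := bV _ Hg; have := up _ Hg; have := up _ (HV _ Hg).
  by rewrite !ler_norml => ? ? /andP[? ?]; lra.
(* Multiplying by [c] or its inverse brings [beta h] closer to 0 by at least 1, as
   long as its absolute value exceeds [T]. *)
pose T := beta c + 2 * D.
exists c => //; exists [set g | H g /\ `|beta g| <= T]; split => //.
  by move=> g [].
move=> h Hh; have [m hm] := exists_nat_ge (`|beta h| - T).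
have {hm} : `|beta h| <= T + m%:R by lra.
elim: m h Hh => [|m IHm] h Hh hm.
  exists h; first by split=> //; rewrite addr0 in hm.
  by rewrite mulVg; exact: cyclic_subgroup1.
have [hT|Th] := lerP `|beta h| T.
  by exists h => //; rewrite mulVg; exact: cyclic_subgroup1.
have := bV _ Hc; have := qm _ _ Hh Hc; have := qm _ _ Hh (HV _ Hc).
move: hm Th; rewrite -natr1 /T.
case: (lerP 0 (beta h)) => b0.
  rewrite (ger0_norm b0) !ler_norml => ? ? /andP[? ?] /andP[? ?] /andP[? ?].
  have [||f Ff cyc] := IHm (h * c^-1)%g; first by apply: HM => //; exact: HV.
    by rewrite ler_norml /T; have := ler0n R m; lra.
  by exists f => //; have := cyclic_subgroupM cyc; rewrite mulgA mulgVK.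
rewrite (ltr0_norm b0) !ler_norml => ? ? /andP[? ?] /andP[? ?] /andP[? ?].
have [||f Ff cyc] := IHm (h * c)%g; first exact: HM.
  by rewrite ler_norml /T; have := ler0n R m; lra.
by exists f => //; have := cyclic_subgroupMV cyc; rewrite mulgA mulgK.
Qed.

End subgroups.

Lemma common_bound {R : realType} N (P : nat -> R -> Prop) :
  (forall i r r', r <= r' -> P i r -> P i r') ->
  (forall i, (i < N)%N -> exists r, P i r) ->
  exists r, forall i, (i < N)%N -> P i r.
Proof.
move=> Pmon; elim: N => [|N IHN] Pex; first by exists 0.
have [|r rP] := IHN; first by move=> i /ltnW; exact: Pex.
have [r' r'P] := Pex N (leqnn _); exists (Num.max r r') => i.
rewrite ltnS leq_eqVlt => /orP[/eqP ->|/rP].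
  by apply: Pmon r'P; rewrite le_max lexx orbT.
by apply: Pmon; rewrite le_max lexx.
Qed.

Section separated.
Context {R : realType} {G : groupType} {X : metricType R}.
Context (a : isometric_action G X) (o : X) (delta : R) (delta_ge0 : 0 <= delta).
Context (hyp : delta_hyperbolic X delta).
Context (properX : proper_space X) (roughX : roughly_geodesic X).
Context (geoa : geometric_action a).
Context (H : set G) (HS : is_subgroup H).

Lemma stab_virtually_cyclic (z : gromov_boundary o) :
  virtually_cyclic (H `&` [set g | bd_act a g z = z]).
Proof.
have [H1 HM HV] := HS.
have [x zx] := bd_class_nonempty z.
have [beta betaP] := busemann_exists a hyp zx.
apply: (@quasimorphism_virtually_cyclic _ R _ beta (8 * delta)).
- split=> [|g h [Hg gz] [Hh hz]|g [Hg gz]].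
  + by split=> //=; rewrite bd_act1.
  + by split; [exact: HM|rewrite /= bd_actM hz].
  + by split; [exact: HV|rewrite /= -[X in bd_act _ _ X]gz bd_actK].
- by move=> g h [_ gz] _; exact: (busemann_quasimorphism hyp zx betaP h gz).
- move=> C.
  have := finite_stab_fibre delta_ge0 hyp properX roughX geoa zx betaP C.
  by apply: sub_finite_set => g [[_ gz] bg].
Qed.

Context (nvcH : ~ virtually_cyclic H).

Lemma infinite_orbit (z : gromov_boundary o) N : exists h : nat -> G,
  (forall i, H (h i)) /\
  (forall i j, (i < N)%N -> (j < N)%N -> i != j -> bd_act a (h i) z <> bd_act a (h j) z).
Proof.
have [H1 HM HV] := HS.
(* With a finite orbit the stabiliser would have finite index. *)
have infO : infinite_set [set bd_act a g z | g in H].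
  move=> finO; apply: nvcH.
  have /choice[f fP] : forall y, exists f, [set bd_act a g z | g in H] y ->
      H f /\ bd_act a f z = y.
    move=> y; case: (pselect ([set bd_act a g z | g in H] y)) => [[f Hf fy]|ny].
      by exists f.
    by exists 1%g.
  apply: virtually_cyclic_extend (stab_virtually_cyclic z);
    [| |exact: HM|exact: (finite_image f finO)|].
  - by move=> g [].
  - by move=> _ [y Oy <-]; have [] := fP _ Oy.
  move=> h Hh; have Oh : [set bd_act a g z | g in H] (bd_act a h z) by exists h.
  have [Hf fz] := fP _ Oh; exists (f (bd_act a h z)); first by exists (bd_act a h z).
  split; first by apply: HM => //; exact: HV.
  by rewrite /= bd_actM -{2}fz bd_actK.
have [B BO cardB] := infinite_set_fset N infO.
have /choice[h hP] : forall i, exists h, H h /\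
    ((i < N)%N -> bd_act a h z = nth z (enum_fset B) i).
  move=> i; case: (ltnP i N) => iN; last by exists 1%g.
  have [|h Hh hi] := BO (nth z (enum_fset B) i); last by exists h.
  by apply/mem_nth; exact: leq_trans iN cardB.
exists h; split=> [i|i j iN jN ij]; first by have [] := hP i.
have [_ ->//] := hP i; have [_ ->//] := hP j => /eqP.
have sB k : (k < N)%N -> (k < size (enum_fset B))%N.
  by move=> kN; exact: leq_trans kN cardB.
by rewrite nth_uniq ?sB ?fset_uniq// (negPf ij).
Qed.

Lemma gromov_product_lip2 x x' y y' :
  gromov_product o x y <= gromov_product o x' y' + mdist x x' + mdist y y'.
Proof.
rewrite /gromov_product; have := metric_triangle x x' o.
have := metric_triangle y y' o; have := metric_triangle x' x y'.
by have := metric_triangle x y y'; rewrite (metric_sym x' x); lra.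
Qed.

Lemma separated_orbits (z z' : gromov_boundary o) x x' :
  z <> z' -> bd_class z x -> bd_class z' x' ->
  exists M, exists n0, forall n, (n0 <= n)%N -> gromov_product o (x n) (x' n) <= M.
Proof.
move=> zz' zx zx'.
have [r nr] : exists r, ~ bd_near r z z'.
  apply: contrapT => allr; apply: zz'; apply: (bd_class_eq hyp zx zx').
  apply/gromov_asymptoticP => M.
  have [|n0 H0] := bd_near_all delta_ge0 hyp (r := M + 1 + 2 * delta) _ zx zx'.
    by apply: contrapT => nr; apply: allr; exists (M + 1 + 2 * delta).
  by exists n0 => i j ni nj; have := H0 i j ni nj; lra.
have [n0 H0] := bd_far delta_ge0 hyp nr zx zx'.
by exists (r + 2 * delta), n0 => n n0n; exact: H0.
Qed.

(** Arbitrarily many long elements of [H] with pairwise distinct directions, as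
    well as their inverses: they are of the form [h i * s * (k i)^-1], where [s]
    tends to infinity with [s o --> p] and [s^-1 o --> q] and the points [h i p]
    are distinct, as well as the points [k i q]. *)
Lemma separated_elements N : exists (K : R) (g : nat -> G),
  forall i, (i < N)%N -> [/\ H (g i), 2 * K <= displ a o (g i) &
    forall j, (j < N)%N -> i != j ->
      gromov_product o (a (g i) o) (a (g j) o) < K - delta /\
      gromov_product o (a (g i)^-1%g o) (a (g j)^-1%g o) < K - delta].
Proof.
have d0 := delta_ge0; have [H1 HM HV] := HS.
pose S (n : nat) := H `&` [set g | n%:R <= displ a o g].
have S0 n : S n !=set0.
  apply: contrapT => Sn; apply: nvcH; apply: virtually_cyclic_finite => //.
  have := finite_displ o properX geoa n%:R; apply: sub_finite_set => g Hg /=.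
  by rewrite leNgt; apply/negP => ng; apply: Sn; exists g; split=> //; exact: ltW.
have FF : ProperFilter (filter_from [set: nat] S).
  apply: filter_from_proper => //; apply: filter_from_filter; first by exists 0%N.
  move=> i j _ _; exists (maxn i j) => // g [Hg /= mg]; split; split=> //=.
    by apply: le_trans mg; rewrite ler_nat leq_maxl.
  by apply: le_trans mg; rewrite ler_nat leq_maxr.
have [U [UU FU]] := ultraFilterLemma FF.
have US n : U (S n) by apply: FU; exists n.
have [c c0 dir] := ultra_direction o delta_ge0 hyp properX roughX.
have /choice[A AP] : forall n, exists A, U A /\ forall g h, A g -> A h ->
    n%:R - c <= gromov_product o (a g o) (a h o).
  move=> n; have [//||A UA An] := dir n%:R _ U (fun g => a g o) UU; last by exists A.
  by apply: filterS (US n) => g [].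
have /choice[A' AP'] : forall n, exists A, U A /\ forall g h, A g -> A h ->
    n%:R - c <= gromov_product o (a g^-1%g o) (a h^-1%g o).
  move=> n; have [//||B UB Bn] := dir n%:R _ U (fun g => a g^-1%g o) UU.
    by apply: filterS (US n) => g [_]; rewrite /= -displV.
  by exists B.
have /choice[s sP] : forall n, exists s, forall q, (q <= n)%N ->
    (S q `&` (A q `&` A' q)) s.
  move=> n; apply: (@filter_ex _ U); apply: filter_seq => q.
  by apply: filterI => //; apply: filterI; [exact: (AP q).1|exact: (AP' q).1].
have gs : gromov_sequence o (fun n => a (s n) o).
  apply/gromov_asymptoticP => M; have [n nM] := exists_nat_ge (M + c).
  exists n => i j ni nj; apply: (@le_trans _ _ (n%:R - c)); first by lra.
  by apply: (AP n).2; [have [_ []] := sP i n ni|have [_ []] := sP j n nj].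
have gs' : gromov_sequence o (fun n => a (s n)^-1%g o).
  apply/gromov_asymptoticP => M; have [n nM] := exists_nat_ge (M + c).
  exists n => i j ni nj; apply: (@le_trans _ _ (n%:R - c)); first by lra.
  by apply: (AP' n).2; [have [_ []] := sP i n ni|have [_ []] := sP j n nj].
have [h [Hh hN]] := infinite_orbit (bd_lim gs) N.
have [k [Hk kN]] := infinite_orbit (bd_lim gs') N.
pose g i n := (h i * s n * (k i)^-1)%g.
pose far r i j n := gromov_product o (a (g i n) o) (a (g j n) o) <= r /\
  gromov_product o (a (g i n)^-1%g o) (a (g j n)^-1%g o) <= r.
pose bnd r i j := exists n0, forall n, (n0 <= n)%N -> far r i j n.
have gk i n : mdist (a (g i n) o) (a (h i) (a (s n) o)) = displ a o (k i).
  by rewrite /g !actM !act_isometry -displV.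
have gh i n : mdist (a (g i n)^-1%g o) (a (k i) (a (s n)^-1%g o)) = displ a o (h i).
  by rewrite /g !invgM invgK !actM !act_isometry -displV.
have bndP i j : (i < N)%N -> (j < N)%N -> exists r, i != j -> bnd r i j.
  move=> iN jN; case: (eqVneq i j) => [_|ij]; first by exists 0.
  have [M [n1 M1]] := separated_orbits (hN i j iN jN ij)
    (bd_act_class a _ (bd_limP gs)) (bd_act_class a _ (bd_limP gs)).
  have [M' [n2 M2]] := separated_orbits (kN i j iN jN ij)
    (bd_act_class a _ (bd_limP gs')) (bd_act_class a _ (bd_limP gs')).
  exists (Num.max (M + displ a o (k i) + displ a o (k j))
             (M' + displ a o (h i) + displ a o (h j))) => _.
  exists (maxn n1 n2) => n; rewrite geq_max => /andP[nn1 nn2]; split.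
    apply: le_trans (gromov_product_lip2 _ (a (h i) (a (s n) o))
      _ (a (h j) (a (s n) o))) _.
    by rewrite !gk le_max; apply/orP; left; have := M1 n nn1 => /=; lra.
  apply: le_trans (gromov_product_lip2 _ (a (k i) (a (s n)^-1%g o))
    _ (a (k j) (a (s n)^-1%g o))) _.
  by rewrite !gh le_max; apply/orP; right; have := M2 n nn2 => /=; lra.
have [K0 K0P] : exists r, forall i, (i < N)%N -> forall j, (j < N)%N ->
    i != j -> bnd r i j.
  have mon i j r r' : r <= r' -> bnd r i j -> bnd r' i j.
    move=> rr' [n0 H0]; exists n0 => n /H0[u v].
    by split; [exact: le_trans u rr'|exact: le_trans v rr'].
  apply: (common_bound (P := fun i r => forall j, (j < N)%N -> i != j -> bnd r i j)).
    by move=> i r r' rr' br j jN ij; apply: mon rr' _; exact: br.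
  move=> i iN; apply: (common_bound (P := fun j r => i != j -> bnd r i j)).
    by move=> j r r' rr' br ij; apply: mon rr' _; exact: br.
  by move=> j jN; exact: bndP.
have [n nP] : exists n, forall m, (n <= m)%N ->
    forall p, ([set i | (i < N)%N] `*` [set i | (i < N)%N]) p ->
    (p.1 != p.2 -> far K0 p.1 p.2 m) /\ 2 * (K0 + delta + 1) <= displ a o (g p.1 m).
  apply: finite_common_nat; first by apply: finite_setX; exact: finite_II.
  move=> [i j] [/= iN jN].
  have [m1 m1P] : exists m, forall n, (m <= n)%N ->
      2 * (K0 + delta + 1) <= displ a o (g i n).
    have [m mP] := exists_nat_ge
      (2 * (K0 + delta + 1) + displ a o (h i) + displ a o (k i)).
    exists m => n mn; have [[_ /= ns] _] := sP n n (leqnn n).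
    have mn' : m%:R <= n%:R :> R by rewrite ler_nat.
    have := @displM _ _ _ a o ((h i)^-1 * g i n)%g (k i).
    have := @displM _ _ _ a o (h i)^-1%g (g i n).
    rewrite displV /g !mulgA mulVg mul1g mulgVK -mulgA; lra.
  case: (eqVneq i j) => [_|ij]; first by exists m1 => n /m1P.
  have [m2 m2P] := K0P i iN j jN ij; exists (maxn m1 m2) => n.
  by rewrite geq_max => /andP[/m1P ? /m2P ?].
exists (K0 + delta + 1), (fun i => g i n) => i iN; split.
- have [[Hs _] _] := sP n n (leqnn n).
  exact: HM (HM _ _ (Hh i) Hs) (HV _ (Hk i)).
- by have [_] := nP n (leqnn n) (i, i) (conj iN iN).
move=> j jN ij; have [/(_ ij)[f1 f2] _] := nP n (leqnn n) (i, j) (conj iN jN).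
by split; lra.
Qed.

End separated.

(** * Sums over a countable group and convolution powers *)

Section esum_complements.
Context {R : realType}.
Local Open Scope ereal_scope.

Lemma esumZ_fin (T : choiceType) (r : R) (f : T -> \bar R) :
  (0 <= r)%R -> (forall t, 0 <= f t) ->
  \esum_(t in [set: T]) (r%:E * f t) = r%:E * \esum_(t in [set: T]) f t.
Proof.
move=> r0 f0; rewrite /esum -ereal_supZl//; last first.
  by apply/set0P; exists 0; exists set0; [exact: fsets_set0|rewrite fsbig_set0].
congr ereal_sup; apply/seteqP; split=> [_ [A finA <-]|_ [_ [A finA <-] <-]].
  exists (\sum_(t \in A) f t); first by exists A.
  by rewrite ge0_mule_fsumr.
by exists A => //; rewrite ge0_mule_fsumr.
Qed.

Lemma esum_exchange (T1 T2 : choiceType) (f : T1 -> T2 -> \bar R) :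
  (forall s t, 0 <= f s t) ->
  \esum_(s in [set: T1]) \esum_(t in [set: T2]) f s t =
  \esum_(t in [set: T2]) \esum_(s in [set: T1]) f s t.
Proof.
move=> f0; rewrite !esum_esum//.
rewrite (@reindex_esum _ _ _ ([set: T2] `*`` (fun=> [set: T1])) _
  (fun p => (p.2, p.1)))//.
split=> [p|[s1 t1] [s2 t2] _ _ /= [-> ->]//|[s t] _]; first by [].
by exists (t, s).
Qed.

Lemma esum_single (T : choiceType) (t : T) (f : T -> \bar R) :
  (forall s, s != t -> f s = 0) -> 0 <= f t ->
  \esum_(s in [set: T]) f s = f t.
Proof.
move=> f0 ft; rewrite -(esum_set1 ft) [RHS]esum_mkcond.
apply: eq_esum => s _; case: ifPn => // st; apply: f0.
by apply: contraNneq st => ->; rewrite inE.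
Qed.

Lemma esum_bij (T : choiceType) (e : T -> T) (f : T -> \bar R) : bijective e ->
  \esum_(t in [set: T]) f (e t) = \esum_(t in [set: T]) f t.
Proof.
move=> [e' eK e'K]; symmetry; apply: reindex_esum.
by split=> // [s t _ _|t _]; [exact: can_inj|exists (e' t)].
Qed.

Lemma esum_term (T : choiceType) (t : T) (f : T -> \bar R) :
  f t <= \esum_(s in [set: T]) f s.
Proof.
by apply: esum_ge; exists [set t]; [split|rewrite fsbig_set1].
Qed.

Lemma esumZl (T : choiceType) (x : \bar R) (f : T -> \bar R) :
  0 <= x -> (forall t, 0 <= f t) ->
  \esum_(t in [set: T]) (x * f t) = x * \esum_(t in [set: T]) f t.
Proof.
case: x => [r| |//] x0 f0; first exact: esumZ_fin.
have [[t ft]|nt] := pselect (exists t, f t != 0).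
  have {}ft : 0 < f t by rewrite lt_def ft f0.
  rewrite gt0_mulye; last exact: lt_le_trans ft (esum_term _ _).
  have := esum_term t (fun s => +oo * f s).
  by rewrite gt0_mulye// leye_eq => /eqP.
have ft0 t : f t = 0 by apply/eqP; apply: contrapT => /negP ft; apply: nt; exists t.
by rewrite !esum1 ?mule0// => t _; rewrite ft0 mule0.
Qed.

End esum_complements.

Lemma countable_enum (T : choiceType) : countable [set: T] -> infinite_set [set: T] ->
  exists e : nat -> T, bijective e.
Proof.
elim/choicePpointed: T => T cT iT; first by case: iT; rewrite emptyE.
have /pcard_eqP[f] : ([set: nat] #= [set: T])%card.
  by rewrite card_eq_sym; exact: eq_card_nat.
by exists f; exact: bijTT.
Qed.

(** Countable additivity over a countable index type, given by a bijection [e]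
    with the natural numbers. *)
Lemma measure_esum (R : realType) d (T : measurableType d)
    (m : {measure set T -> \bar R}) (I : choiceType) (e : nat -> I)
    (A : I -> set T) : bijective e ->
  (forall i, measurable (A i)) -> (forall i j, A i `&` A j !=set0 -> i = j) ->
  m (\bigcup_i A i) = (\esum_(i in [set: I]) m (A i))%E.
Proof.
move=> be mA tA; have [e' eK e'K] := be.
have -> : \bigcup_i A i = \bigcup_n A (e n).
  apply/seteqP; split=> [t [i _ it]|t [n _ nt]]; last by exists (e n).
  by exists (e' i) => //; rewrite e'K.
rewrite measure_semi_bigcup//; last exact: bigcupT_measurable.
  rewrite nneseries_esumT//; symmetry; apply: reindex_esum.
  by split=> // [i j _ _|i _]; [exact: can_inj|exists (e' i)].
by move=> i j _ _ /tA /(can_inj eK).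
Qed.

Arguments convolution_power : simpl never.

Section walk_mean.
Context {R : realType} {G : groupType} (mu : probability (discrete_group G) R).
Context (e : nat -> G) (be : bijective e).
Local Open Scope ereal_scope.
Local Notation conv := (convolution_power mu).

(** [walk_mean n F] is the mean of [F] at time [n] of the random walk. It is meant
    for nonnegative [F]. *)
Definition walk_mean n (F : G -> \bar R) : \bar R :=
  \esum_(g in [set: G]) (F g * conv n g).

Lemma conv0 g : conv 0 g = (g == 1%g)%:R%:E.
Proof. by rewrite /convolution_power; case: eqP. Qed.

Lemma convS n g : conv n.+1 g =
  \esum_(h in [set: G]) (conv n h * mu [set h^-1 * g]%g).
Proof. by []. Qed.

Lemma conv_ge0 n g : 0 <= conv n g.
Proof.
elim: n g => [|n IHn] g; first by rewrite conv0 lee_fin.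
by rewrite convS; apply: esum_ge0 => h _; rewrite mule_ge0.
Qed.

Lemma esum_mu (A : set G) : mu A = \esum_(g in [set: G]) mu (A `&` [set g]).
Proof.
rewrite -(@measure_esum _ _ _ mu G e (fun g => A `&` [set g]) be)//.
  by congr (mu _); apply/seteqP; split=> [g Ag|g [h _ []]//]; exists g.
by move=> g h [k [[_ <-] [_ <-]]].
Qed.

Lemma conv1 g : conv 1 g = mu [set g].
Proof.
rewrite convS (@esum_single _ _ 1%g).
- by rewrite conv0 eqxx mul1e invg1 mul1g.
- by move=> h h1; rewrite conv0 (negPf h1) mul0e.
- by rewrite conv0 eqxx mul1e.
Qed.

Lemma walk_mean_ge0 n F : (forall g, 0 <= F g) -> 0 <= walk_mean n F.
Proof. by move=> F0; apply: esum_ge0 => g _; rewrite mule_ge0// conv_ge0. Qed.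

Lemma walk_mean_le n F F' : (forall g, F g <= F' g) ->
  walk_mean n F <= walk_mean n F'.
Proof. by move=> FF'; apply: le_esum => g _; rewrite lee_wpmul2r// conv_ge0. Qed.

Lemma eq_walk_mean n F F' : (forall g, F g = F' g) -> walk_mean n F = walk_mean n F'.
Proof. by move=> FF'; apply: eq_esum => g _; rewrite FF'. Qed.

Lemma walk_meanD n F F' : (forall g, 0 <= F g) -> (forall g, 0 <= F' g) ->
  walk_mean n (fun g => F g + F' g) = walk_mean n F + walk_mean n F'.
Proof.
move=> F0 F'0; rewrite /walk_mean -esumD//; last 2 first.
- by move=> g _; rewrite mule_ge0// conv_ge0.
- by move=> g _; rewrite mule_ge0// conv_ge0.
by apply: eq_esum => g _; rewrite ge0_muleDl.
Qed.

Lemma walk_meanZ n r F : (0 <= r)%R -> (forall g, 0 <= F g) ->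
  walk_mean n (fun g => r%:E * F g) = r%:E * walk_mean n F.
Proof.
move=> r0 F0; rewrite /walk_mean -esumZl//; last first.
  by move=> g; rewrite mule_ge0// conv_ge0.
by apply: eq_esum => g _; rewrite muleA.
Qed.

Lemma walk_mean0 F : 0 <= F 1%g -> walk_mean 0 F = F 1%g.
Proof.
move=> F1; rewrite /walk_mean (@esum_single _ _ 1%g).
- by rewrite conv0 eqxx mule1.
- by move=> h h1; rewrite conv0 (negPf h1) mule0.
- by rewrite conv0 eqxx mule1.
Qed.

Lemma walk_meanS n F : (forall g, 0 <= F g) ->
  walk_mean n.+1 F = walk_mean n (fun a => walk_mean 1 (fun b => F (a * b)%g)).
Proof.
move=> F0; rewrite /walk_mean.
have -> : \esum_(g in [set: G]) F g * conv n.+1 g =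
    \esum_(g in [set: G]) \esum_(h in [set: G]) (F g * (conv n h * mu [set h^-1 * g]%g)).
  apply: eq_esum => g _.
  by rewrite convS esumZl// => h; rewrite mule_ge0// conv_ge0.
rewrite esum_exchange; last first.
  by move=> g h; rewrite !mule_ge0// conv_ge0.
apply: eq_esum => a _; rewrite muleC -esumZl ?conv_ge0//; last first.
  by move=> b; rewrite mule_ge0// conv_ge0.
rewrite -(esum_bij (e := fun b => a * b)%g); last first.
  by exists (fun b => a^-1 * b)%g => b; rewrite mulgA ?mulVg ?mulgV mul1g.
by apply: eq_esum => b _; rewrite conv1 mulKg muleCA.
Qed.

Lemma walk_mean_cst n (x : \bar R) : 0 <= x -> walk_mean n (fun=> x) = x.
Proof.
move=> x0; elim: n => [|n IHn]; first by rewrite walk_mean0.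
rewrite walk_meanS// (_ : (fun a => _) = (fun=> x))//; apply/funext => a.
rewrite /walk_mean esumZl ?conv_ge0// => [|b]; last exact: conv_ge0.
rewrite (eq_esum (b := fun g => mu ([set: G] `&` [set g]))) -?esum_mu.
  by rewrite probability_setT mule1.
by move=> g _; rewrite conv1 setTI.
Qed.

(** The Markov property: the first [n] and the last [m] increments are
    independent. *)
Lemma walk_meanM n m F : (forall g, 0 <= F g) ->
  walk_mean (n + m) F = walk_mean n (fun a => walk_mean m (fun b => F (a * b)%g)).
Proof.
elim: m F => [|m IHm] F F0.
  rewrite addn0; apply: eq_walk_mean => a.
  by rewrite walk_mean0 mulg1.
rewrite addnS walk_meanS// IHm => [|a]; last exact: walk_mean_ge0.
apply: eq_walk_mean => a; rewrite walk_meanS//.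
by apply: eq_walk_mean => b; apply: eq_walk_mean => c; rewrite mulgA.
Qed.

Lemma walk_mean_exchange n m (F : G -> G -> \bar R) : (forall g h, 0 <= F g h) ->
  walk_mean n (fun g => walk_mean m (fun h => F g h)) =
  walk_mean m (fun h => walk_mean n (fun g => F g h)).
Proof.
move=> F0; rewrite /walk_mean.
rewrite (eq_esum (b := fun g =>
    \esum_(h in [set: G]) (conv n g * (F g h * conv m h)))); last first.
  move=> g _; rewrite muleC esumZl ?conv_ge0// => h.
  by rewrite mule_ge0// conv_ge0.
rewrite esum_exchange; last by move=> g h; rewrite !mule_ge0// conv_ge0.
apply: eq_esum => h _; rewrite muleC -esumZl ?conv_ge0//; last first.
  by move=> g; rewrite mule_ge0// conv_ge0.
by apply: eq_esum => g _; rewrite muleCA [conv n g * _]muleC [RHS]muleCA.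
Qed.

Lemma conv_mean n g : conv n g = walk_mean n (fun h => (h == g)%:R%:E).
Proof.
rewrite /walk_mean (@esum_single _ _ g) ?eqxx ?mul1e ?conv_ge0//.
by move=> h hg; rewrite (negPf hg) mul0e.
Qed.

Lemma conv_le1 n g : conv n g <= 1.
Proof.
rewrite conv_mean -[leRHS](walk_mean_cst n)//.
by apply: walk_mean_le => h; rewrite lee_fin; case: eqP.
Qed.

Lemma conv_fin n g : conv n g \is a fin_num.
Proof.
rewrite fin_numElt (lt_le_trans _ (conv_ge0 n g))//=.
by rewrite (le_lt_trans (conv_le1 n g))// ltry.
Qed.

Lemma convM n m g :
  conv (n + m) g = walk_mean n (fun h => conv m (h^-1 * g)%g).
Proof.
rewrite conv_mean walk_meanM; last by move=> h; rewrite lee_fin.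
apply: eq_walk_mean => h; rewrite conv_mean; apply: eq_walk_mean => k.
by congr ((_ : bool)%:R%:E); apply/eqP/eqP => [<-|->]; rewrite ?mulKg ?mulVKg.
Qed.

Lemma conv_ge n m g h : conv n g * conv m h <= conv (n + m) (g * h)%g.
Proof.
rewrite convM muleC.
by apply: le_trans (esum_term g _) => /=; rewrite mulKg.
Qed.

Context (mu_sym : symmetric_measure mu).

Lemma walk_meanV n F : (forall g, 0 <= F g) ->
  walk_mean n (fun g => F g^-1%g) = walk_mean n F.
Proof.
elim: n F => [|n IHn] F F0; first by rewrite !walk_mean0// invg1.
have V1 F' : (forall g, 0 <= F' g) ->
    walk_mean 1 (fun g => F' g^-1%g) = walk_mean 1 F'.
  move=> F'0; rewrite /walk_mean -(esum_bij (e := fun g => g^-1)%g)/=; last first.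
    by exists (fun g => g^-1)%g => g; rewrite invgK.
  by apply: eq_esum => g _ /=; rewrite invgK !conv1 -mu_sym.
rewrite walk_meanS//.
under [LHS]eq_walk_mean => a.
  rewrite (@eq_walk_mean 1 _ (fun b => F (b^-1 * a^-1)%g)); last first.
    by move=> b; rewrite invgM.
  rewrite (V1 (fun b => F (b * a^-1)%g))//; over.
rewrite walk_mean_exchange//.
under eq_walk_mean => b do rewrite (IHn (fun a => F (b * a)%g))//.
by rewrite -walk_meanM.
Qed.

Lemma convV n g : conv n g^-1%g = conv n g.
Proof.
rewrite !conv_mean -(@walk_meanV n (fun h => (h == g)%:R%:E)).
  apply: eq_walk_mean => h; congr ((_ : bool)%:R%:E).
  by apply/eqP/eqP => [->|<-]; rewrite invgK.
by move=> h; rewrite lee_fin.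
Qed.

End walk_mean.

(** * Exponential decay of the return probabilities *)

Section decay.
Context {R : realType} {G : groupType} (mu : probability (discrete_group G) R).
Context (e : nat -> G) (be : bijective e) (mu_sym : symmetric_measure mu).
Local Notation conv := (convolution_power mu).
Local Notation walk_mean := (walk_mean mu).
Local Open Scope ereal_scope.

Let f n g : R := fine (conv n g).

Let fE n g : conv n g = (f n g)%:E.
Proof. by rewrite /f fineK// (conv_fin mu be). Qed.

Let f_ge0 n g : (0 <= f n g)%R.
Proof. by rewrite -lee_fin -fE conv_ge0. Qed.

(** By symmetry of [mu], the law at time [2 n] is the autocorrelation of the law at
    time [n]. *)
Lemma conv_double n g :
  conv (n + n) g = \esum_(x in [set: G]) (f n x * f n (g^-1 * x)%g)%:E.
Proof.
rewrite convM; apply: eq_esum => x _.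
by rewrite -(convV mu_sym) invgM invgK !fE -EFinM mulrC.
Qed.

(** A Schur test: [A] distributes the terms of the autocorrelation. *)
Lemma conv_double_le n g (A : G -> R) : (forall x, 0 <= A x)%R ->
  (forall x, f n x * f n (g^-1 * x)%g <=
     A x * f n x ^+ 2 + A (g^-1 * x)%g * f n (g^-1 * x)%g ^+ 2)%R ->
  conv (n + n) g <= \esum_(x in [set: G]) (2 * A x * f n x ^+ 2)%:E.
Proof.
move=> A0 fA; rewrite conv_double.
pose F x : \bar R := (A x * f n x ^+ 2)%:E.
have F0 x : 0 <= F x by rewrite lee_fin mulr_ge0// sqr_ge0.
apply: (@le_trans _ _ (\esum_(x in [set: G]) (F x + F (g^-1 * x)%g))).
  by apply: le_esum => x _; rewrite -EFinD lee_fin.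
rewrite esumD// (esum_bij (e := fun x => g^-1 * x)%g); last first.
  by exists (fun x => g * x)%g => x; rewrite mulgA ?mulVg ?mulgV mul1g.
rewrite -esumD//; apply: le_esum => x _.
by rewrite -EFinD lee_fin; lra.
Qed.

Lemma conv_double1 n :
  conv (n + n) 1%g = \esum_(x in [set: G]) (f n x ^+ 2)%:E.
Proof.
by rewrite conv_double; apply: eq_esum => x _; rewrite invg1 mul1g expr2.
Qed.

Lemma conv_double_le1 n g : conv (n + n) g <= conv (n + n) 1%g.
Proof.
rewrite conv_double1; apply: le_trans (@conv_double_le n g (fun=> 2^-1%R) _ _) _.
- by move=> _; rewrite invr_ge0.
- move=> x; have := sqr_ge0 (f n x - f n (g^-1 * x)%g)%R.
  by rewrite sqrrB => ?; lra.
by apply: le_esum => x _; rewrite divff// mul1r.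
Qed.

(** If translation by [g i] sends the complement of [C i] into [C i] and the ten sets
    [C i] cover no point more than twice, then the autocorrelation at some [g i] is a
    definite fraction smaller than the return probability. *)
Lemma conv_double_contract (g : nat -> G) (C : nat -> pred G) n :
  (forall i x, (i < 10)%N -> C i x || C i ((g i)^-1 * x)%g) ->
  (forall x, \sum_(i < 10) (C i x)%:R <= 2 :> R)%R ->
  exists2 i, (i < 10)%N & conv (n + n) (g i) <= (4 / 5)%:E * conv (n + n) 1%g.
Proof.
(* In each pair [x], [(g i)^-1 * x] at least one point has weight 1, which makes
   [u * v <= u ^ 2 + v ^ 2 / 4] sufficient. Summed over [i], the weights of a point
   are at most [2 * 1 + 8 / 4 = 4], hence the bound [8] on ten terms. *)
move=> gC C2; pose A i x : R := if C i x then 1%R else (1 / 4)%R.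
have A0 i x : (0 <= A i x)%R by rewrite /A; case: ifP => _; lra.
have gA (i : 'I_10) : conv (n + n) (g i) <=
    \esum_(x in [set: G]) (2 * A i x * f n x ^+ 2)%:E.
  apply: conv_double_le => // x; have := gC i x (ltn_ord i).
  set u := f n x; set v := f n _; have u0 := sqr_ge0 u; have v0 := sqr_ge0 v.
  have := sqr_ge0 (u - v / 2)%R; have := sqr_ge0 (u / 2 - v)%R.
  have := sqr_ge0 (u - v)%R; rewrite /A !sqrrB.
  by case: (C i x) => /=; case: (C i _) => //= *; lra.
have gS : \sum_(i < 10) conv (n + n) (g i) <= 8%:E * conv (n + n) 1%g.
  apply: le_trans (lee_sum _ (fun i _ => gA i)) _.
  rewrite -esum_sum; last first.
    by move=> i x _ _; rewrite lee_fin !mulr_ge0// sqr_ge0.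
  rewrite conv_double1 -esumZl//; last by move=> x; rewrite lee_fin sqr_ge0.
  apply: le_esum => x _; rewrite sumEFin -EFinM lee_fin -mulr_suml -mulr_sumr.
  apply: ler_wpM2r; first exact: sqr_ge0.
  have -> : (\sum_(i < 10) A i x = 10 / 4 + 3 / 4 * \sum_(i < 10) (C i x)%:R)%R.
    rewrite mulr_sumr; transitivity (\sum_(i < 10) ((1 / 4 + 3 / 4 * (C i x)%:R) : R))%R.
      by apply: eq_bigr => i _; rewrite /A; case: (C i x) => /=; lra.
    by rewrite big_split/= sumr_const card_ord; lra.
  by have := C2 x; lra.
have {}gS : (\sum_(i < 10) f (n + n) (g i) <= 8 * f (n + n) 1%g)%R.
  rewrite -lee_fin -sumEFin EFinM -fE; apply: le_trans gS.
  by apply: lee_sum => i _; rewrite fE.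
apply: contrapT => nog; move: gS; rewrite leNgt => /negP; apply.
have -> : (8 * f (n + n) 1%g = \sum_(i < 10) 4 / 5 * f (n + n) 1%g)%R.
  by rewrite sumr_const card_ord; lra.
apply: ltr_sum; first by apply/hasP; exists ord0; rewrite ?mem_index_enum.
move=> i _; rewrite -lte_fin EFinM -!fE ltNge; apply/negP => gi.
by apply: nog; exists i.
Qed.

Lemma conv2_gt0 : 0 < conv 2 1%g.
Proof.
rewrite lt_def conv_ge0 andbT; apply/eqP => c20.
have f0 g : conv 1 g = 0.
  have := esum_term g (fun x => (f 1 x ^+ 2)%:E).
  rewrite -(conv_double1 1) c20 fE lee_fin => ff; congr EFin; apply/eqP.
  by rewrite -(sqrf_eq0 (f 1 g)) eq_le ff sqr_ge0.
have := walk_mean_cst mu be 1 (@lee01 R).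
rewrite /walk_mean esum1 => [/esym/eqP|g _]; last by rewrite f0 mule0.
by rewrite onee_eq0.
Qed.

(** The group of the elements of even length over the support of [mu]. Even lengths
    make all large times of the walk admissible ([even_supportP]). *)
Definition even_support : set G := [set g | exists m, conv (m + m) g != 0].

Lemma even_supportP g : even_support g ->
  exists m0, forall m, (m0 <= m)%N -> 0 < conv (m + m) g.
Proof.
move=> [m0 m0g]; exists m0 => m /subnK <-; elim: (m - m0)%N => [|k IHk].
  by rewrite add0n lt_def m0g conv_ge0.
have -> : (k.+1 + m0 + (k.+1 + m0) = 2 + (k + m0 + (k + m0)))%N by lia.
rewrite -[g]mul1g; apply: lt_le_trans (conv_ge _ _ _ _ _).
by rewrite mule_gt0// conv2_gt0.
Qed.

Lemma even_support_subgroup : is_subgroup even_support.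
Proof.
split=> [|g h [m mg] [k kh]|g [m mg]].
- by exists 0%N; rewrite addn0 conv0 eqxx onee_neq0.
- exists (m + k)%N; rewrite gt_eqF// addnACA.
  apply: lt_le_trans (conv_ge _ _ _ _ _).
  by rewrite mule_gt0// lt_def conv_ge0 andbT.
- by exists m; rewrite convV.
Qed.

(** Each [2 M] steps, with [M] such that all the [g i] are charged at time [2 M],
    multiply the return probability by at most a constant [kappa < 1]. *)
Lemma conv_decay (g : nat -> G) (C : nat -> pred G) :
  (forall i, (i < 10)%N -> even_support (g i)) ->
  (forall i x, (i < 10)%N -> C i x || C i ((g i)^-1 * x)%g) ->
  (forall x, \sum_(i < 10) (C i x)%:R <= 2 :> R)%R ->
  exists M (kappa : R), [/\ (0 < M)%N, (0 <= kappa < 1)%R &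
    forall j x, conv (j * M + j * M) x <= (kappa ^+ j)%:E].
Proof.
move=> gE gC C2.
have [M0 M0P] : exists N, forall n, (N <= n)%N ->
    forall i, [set i | (i < 10)%N] i -> 0 < conv (n + n) (g i).
  apply: finite_common_nat; first exact: finite_II.
  by move=> i /gE/even_supportP.
pose M := M0.+1.
have gM i : (i < 10)%N -> (0 < f (M + M) (g i))%R.
  by move=> i10; rewrite -lte_fin -fE; apply: M0P.
have [c [c0 c1 cP]] : exists c : R, [/\ (0 < c)%R, (c <= 1)%R &
    forall i, (i < 10)%N -> (c <= f (M + M) (g i))%R].
  have [r rP] : exists r : R, forall i, (i < 10)%N ->
      (forall s, s = f (M + M) (g i) -> s^-1 <= r)%R.
    apply: (common_bound (P := fun i r => forall s, s = f (M + M) (g i) -> s^-1 <= r)%R).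
      by move=> i r r' rr' H s /H/le_trans; apply.
    by move=> i _; exists (f (M + M) (g i))^-1%R => s ->.
  have r1 : (0 < `|r| + 1)%R by rewrite ltr_wpDl.
  exists (`|r| + 1)^-1%R; split; first by rewrite invr_gt0.
    by rewrite invf_le1// lerDr.
  move=> i i10; rewrite -[leRHS]invrK lef_pV2 ?posrE ?invr_gt0 ?gM//.
  apply: le_trans (rP i i10 _ erefl) _.
  by rewrite (le_trans (ler_norm r))// lerDl.
pose S n := f (n + n) 1%g.
have step n : (S (n + M)%N <= (1 - c / 5) * S n)%R.
  have [i i10] := conv_double_contract n gC C2; rewrite !fE -EFinM lee_fin => fi.
  have S0 : (0 <= S n / 5)%R by rewrite divr_ge0// f_ge0.
  have : walk_mean (M + M) (fun h => conv (n + n) h +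
      (S n / 5)%:E * (h == g i)%:R%:E) <= (S n)%:E.
    have Sn0 : 0 <= (S n)%:E by rewrite lee_fin f_ge0.
    rewrite -[leRHS](walk_mean_cst mu be (M + M) Sn0).
    apply: walk_mean_le => h; rewrite -fE.
    case: eqP => [->|_]; last by rewrite mule0 adde0; exact: conv_double_le1.
    by rewrite mule1 !fE -EFinD lee_fin /S; lra.
  rewrite (@walk_meanD _ _ mu _ (conv (n + n))
    (fun h => (S n / 5)%:E * (h == g i)%:R%:E)) => [|h|h]; last 2 first.
  - exact: conv_ge0.
  - by rewrite mule_ge0// lee_fin.
  rewrite walk_meanZ// -?conv_mean.
  have -> : walk_mean (M + M) (conv (n + n)) = (S (n + M)%N)%:E.
    rewrite /S -fE addnACA addnC convM; apply: eq_walk_mean => h.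
    by rewrite mulg1 convV.
  rewrite fE -EFinM -EFinD lee_fin.
  have : (S n / 5 * c <= S n / 5 * f (M + M) (g i))%R by rewrite ler_wpM2l// cP.
  by lra.
have k0 : (0 <= 1 - c / 5)%R by lra.
exists M, (1 - c / 5)%R; split=> //; first by apply/andP; split=> //; lra.
move=> j x; apply: le_trans (conv_double_le1 _ _) _.
rewrite fE lee_fin -/(S _); elim: j => [|j IHj].
  by rewrite mul0n expr0 /S -lee_fin -fE (conv_le1 mu be).
rewrite mulSn addnC exprS; apply: le_trans (step _) _.
exact: ler_wpM2l.
Qed.

End decay.

(** * The random walk contracts pairs of boundary points *)

Section even_support.
Context {R : realType} {G : groupType} (mu : probability (discrete_group G) R).
Context (e : nat -> G) (be : bijective e) (mu_sym : symmetric_measure mu).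
Local Notation conv := (convolution_power mu).
Local Open Scope ereal_scope.

Lemma conv_gt0 n g : conv n g != 0 -> 0 < conv n g.
Proof. by rewrite lt_def conv_ge0 andbT. Qed.

Lemma conv_neq0M n m g h :
  conv n g != 0 -> conv m h != 0 -> conv (n + m) (g * h)%g != 0.
Proof.
move=> /conv_gt0 ng /conv_gt0 mh; rewrite gt_eqF//.
by apply: lt_le_trans (conv_ge _ _ _ _ _); rewrite mule_gt0.
Qed.

Lemma generated_semigroupP g :
  generated_semigroup (measure_support mu) g <-> exists n, conv n.+1 g != 0.
Proof.
split.
  apply: (@smallest_sub _ _ _ [set h | exists n, conv n.+1 h != 0]) => /=.
    move=> h k [n nh] [m mk]; exists (n + m.+1)%N.
    by rewrite -addSn; exact: conv_neq0M.
  by move=> h muh; exists 0%N; rewrite conv1.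
move=> [n]; elim: n g => [|n IHn] g ng.
  by move=> A [_ SA]; apply: SA; rewrite /measure_support /= -conv1.
have [h nh hg] : exists2 h, conv n.+1 h != 0 & mu [set h^-1 * g]%g != 0.
  apply: contrapT => noh; move/eqP: ng; apply; rewrite convS esum1// => h _.
  apply/eqP; rewrite mule_eq0; apply/orP; case: (eqVneq (conv n.+1 h) 0) => [_|nh].
    by left.
  by right; apply: contrapT => /negP hg; apply: noh; exists h.
move=> A [AM SA]; rewrite -(mulVKg h g).
by apply: (AM); [exact: IHn nh A (conj AM SA)|exact: SA].
Qed.

Lemma even_support_non_elementary : non_elementary_measure mu ->
  ~ virtually_cyclic (even_support mu).
Proof.
move=> ne vc; apply: ne.
have [s muS] : exists s, mu [set s] != 0.
  apply: contrapT => nos; have := walk_mean_cst mu be 1 (@lee01 R).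
  rewrite /walk_mean esum1 => [/esym/eqP|g _]; first by rewrite onee_eq0.
  rewrite conv1 mul1e; apply/eqP; apply: contrapT => /negP gs.
  by apply: nos; exists g.
have s1 : conv 1 s != 0 by rewrite conv1.
have sV1 : conv 1 s^-1%g != 0 by rewrite convV.
have gen1 : generated_semigroup (measure_support mu) 1%g.
  apply/generated_semigroupP; exists 1%N; rewrite -(mulgV s).
  exact: (@conv_neq0M 1 1).
apply: (@virtually_cyclic_extend _ _ _ [set 1%g; s]) vc.
- move=> g [[|m] mg]; last by apply/generated_semigroupP; eexists; exact: mg.
  by move: mg; rewrite addn0 conv0; case: (eqVneq g 1%g) => [-> //|_]; rewrite mulr0n eqxx.
- by move=> _ [->//|->]; apply/generated_semigroupP; exists 0%N.
- move=> g h /generated_semigroupP[n ng] /generated_semigroupP[m mh].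
  apply/generated_semigroupP; exists (n + m.+1)%N.
  by rewrite -addSn; exact: conv_neq0M.
- exact: finite_set2.
move=> h /generated_semigroupP[n nh].
case: (boolP (odd n)) => on.
  exists 1%g; first by left.
  exists n.+1./2; rewrite invg1 mul1g addnn (_ : n.+1./2.*2 = n.+1)//.
  by rewrite -[RHS]odd_double_half /= on.
exists s; first by right.
exists n.+2./2; rewrite addnn (_ : n.+2./2.*2 = 1 + n.+1)%N.
  exact: conv_neq0M.
by rewrite -[RHS]odd_double_half /= (negPf on).
Qed.

End even_support.

Section counting.
Context {R : realType} {G : groupType} {X : metricType R}.
Context (a : isometric_action G X) (o : X) (delta : R) (delta_ge0 : 0 <= delta).
Context (hyp : delta_hyperbolic X delta).
Context (properX : proper_space X) (roughX : roughly_geodesic X).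
Context (geoa : geometric_action a).

(** At most linearly many points of the orbit in a large ball are close to the
    line from [z] to [z'], uniformly in [z] and [z']: such points at almost the same
    distance of a far point towards [z] are close to each other. *)
Lemma far_count r : exists N : nat, forall (z z' : gromov_boundary o) (T : R)
    (F : seq G), 0 <= T -> uniq F ->
  (forall g, g \in F -> displ a o g <= T /\
     ~ bd_near r (bd_act a g z) (bd_act a g z')) ->
  (size F <= (Num.truncn (2 * T)).+1 * N)%N.
Proof.
have d0 := delta_ge0; pose r' := r + 2 * delta.
have finB := finite_displ o properX geoa (2 * r' + 1 + 2 * delta).
have /finite_fsetP[B BE] := finB.
exists #|` B|; move=> z z' T F T0 uF FP.
have [x zx] := bd_class_nonempty z; have [y zy] := bd_class_nonempty z'.
have [n nP] : exists N, forall n, (N <= n)%N -> forall g, [set` F] g ->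
    gromov_product (a g^-1%g o) (x n) (y n) <= r'.
  apply: finite_common_nat; first exact: finite_seq.
  move=> g /FP[_ far].
  have [N NP] := bd_far delta_ge0 hyp far (bd_act_class a g zx) (bd_act_class a g zy).
  by exists N => n Nn; rewrite -gromov_product_actV; exact: NP.
have {}nP := nP n (leqnn n).
(* [h g] is the position of [g^-1 o] along the line, in [[0, 2 * T]]. An element is
   determined by the integer part [b g] of its position and by its quotient by one
   chosen element [rep (b g)] with the same integer part, which has bounded
   displacement. *)
pose h g := mdist (a g^-1%g o) (x n) - mdist o (x n) + T.
have hP g : g \in F -> 0 <= h g <= 2 * T.
  move=> /FP[gT _]; have := metric_triangle (a g^-1%g o) o (x n).
  have := metric_triangle o (a g^-1%g o) (x n); rewrite (metric_sym o (a _ _)).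
  have := displV a (o := o) g; rewrite /h /displ in gT *; lra.
pose b g := Num.truncn (h g).
have /choice[rep repP] : forall k, exists f, (exists2 g, g \in F & b g = k) ->
    f \in F /\ b f = k.
  move=> k; case: (pselect (exists2 g, g \in F & b g = k)) => [[g gF gk]|ng].
    by exists g.
  by exists 1%g.
pose phi g := (b g, (g * (rep (b g))^-1)%g).
have uphi : uniq [seq phi g | g <- F].
  rewrite map_inj_in_uniq// => g1 g2 _ _ [-> ].
  by move/mulIg.
rewrite -(size_map phi) -(size_iota 0 (Num.truncn (2 * T)).+1).
rewrite -(size_allpairs (fun k g => (k, g)) _ (enum_fset B)).
apply: uniq_leq_size => // _ /mapP[g gF ->].
apply/allpairsP; exists (phi g); split=> //.
  rewrite mem_iota /= add0n ltnS; apply: le_truncn.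
  by have /andP[] := hP g gF.
have [repF bg] := repP (b g) (ex_intro2 _ _ g gF erefl).
have : [set g | displ a o g <= 2 * r' + 1 + 2 * delta] (g * (rep (b g))^-1)%g;
  last by rewrite BE.
rewrite /= /displ actM -(act_isometry a g^-1%g) (actK a g) metric_sym.
apply: (almost_segment_close hyp (x := x n) (y := y n)); [exact: nP|exact: nP|].
have /andP[g0 _] := hP g gF; have /andP[f0 _] := hP _ repF.
have /andP[] := truncn_itv g0; have /andP[] := truncn_itv f0.
rewrite -/(b g) -/(b (rep _)) bg -natr1 /h ler_norml; lra.
Qed.

End counting.

Lemma expr_small (R : realType) (k : R) : 0 <= k < 1 ->
  forall eta, 0 < eta -> exists n, k ^+ n <= eta.
Proof.
move=> /andP[k0 k1] eta eta0.
have : (fun n => k ^+ n) @ \oo --> (0 : R).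
  by apply: cvg_expr; rewrite ger0_norm.
move=> /cvgrPdist_le/(_ _ eta0)[n _ /(_ n (leqnn n))].
by rewrite /= sub0r normrN ger0_norm ?exprn_ge0// => ?; exists n.
Qed.

(** [j * k ^ j] is halved when [j] is doubled, once [k ^ j <= 1 / 4]. *)
Lemma linear_expr_small (R : realType) (k : R) : 0 <= k < 1 ->
  forall eta, 0 < eta -> exists2 j, (0 < j)%N & j%:R * k ^+ j <= eta.
Proof.
move=> k01 eta eta0; have /andP[k0 k1] := k01.
have [j0 j0P] := expr_small k01 (eta := 1 / 4) ltac:(lra).
have kj j : (j0 <= j)%N -> k ^+ j <= 1 / 4.
  by move=> jj; apply: le_trans j0P; apply: ler_wiXn2l => //; exact: ltW.
have half i : (2 ^ i * j0.+1)%N%:R * k ^+ (2 ^ i * j0.+1) <= (1 / 2) ^+ i * j0.+1%:R.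
  elim: i => [|i IHi].
    by rewrite mul1n expr0 mul1r ler_piMr// exprn_ile1// ltW.
  rewrite expnS -mulnA mul2n -addnn natrD exprD exprS.
  set m := (2 ^ i * j0.+1)%N in IHi *.
  have mj : (j0 <= m)%N.
    by rewrite /m (leq_trans (leqnSn j0))// leq_pmull// expn_gt0.
  have v4 := kj _ mj; have v0 := exprn_ge0 m k0.
  have u0 : 0 <= m%:R * k ^+ m by rewrite mulr_ge0.
  have -> : (m%:R + m%:R) * (k ^+ m * k ^+ m) = 2 * (m%:R * k ^+ m) * k ^+ m by lra.
  have : 2 * (m%:R * k ^+ m) * k ^+ m <= 2 * (m%:R * k ^+ m) * (1 / 4).
    by apply: ler_wpM2l => //; rewrite mulr_ge0.
  lra.
have [i iP] := expr_small (k := 1 / 2) ltac:(lra)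
  (eta := eta / j0.+1%:R) ltac:(by rewrite divr_gt0).
exists (2 ^ i * j0.+1)%N; first by rewrite muln_gt0 expn_gt0.
by apply: le_trans (half i) _; rewrite -ler_pdivlMr.
Qed.

Section contraction.
Context {R : realType} {G : groupType} {X : metricType R}.
Context (a : isometric_action G X) (o : X) (delta : R) (delta_ge0 : 0 <= delta).
Context (hyp : delta_hyperbolic X delta).
Context (properX : proper_space X) (roughX : roughly_geodesic X).
Context (geoa : geometric_action a) (mu : probability (discrete_group G) R).
Context (e : nat -> G) (be : bijective e) (mu_sym : symmetric_measure mu).
Context (ne_mu : non_elementary_measure mu) (mom : first_moment mu a o).
Local Notation conv := (convolution_power mu).
Local Notation walk_mean := (walk_mean mu).
Local Open Scope ereal_scope.

Lemma exclusive_sum (P : nat -> bool) N :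
  (forall i j, (i < N)%N -> (j < N)%N -> P i -> P j -> i = j) ->
  (\sum_(i < N) (P i)%:R <= 1 :> R)%R.
Proof.
move=> Puniq; have [[i Pi]|noP] := pselect (exists i : 'I_N, P i).
  rewrite (bigD1 i)//= big1 => [|j ji]; first by rewrite Pi addr0.
  case: (boolP (P j)) => // Pj; move: ji; rewrite -val_eqE /=.
  by rewrite (Puniq j i (ltn_ord j) (ltn_ord i) Pj Pi) eqxx.
rewrite big1// => i _; case: (boolP (P i)) => // Pi.
by case: noP; exists i.
Qed.

(** The shadows of ten separated elements of even length, taken as the sets of
    [conv_decay]. *)
Lemma walk_decay : exists M (kappa : R), [/\ (0 < M)%N, (0 <= kappa < 1)%R &
    forall j x, conv (j * M + j * M) x <= (kappa ^+ j)%:E].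
Proof.
have [K [g gP]] := separated_elements o delta_ge0 hyp properX roughX geoa
  (even_support_subgroup mu_sym) (even_support_non_elementary be mu_sym ne_mu) 10.
pose A i x := (K <= gromov_product o (a (g i) o) (a x o))%R.
pose B i x := (K <= gromov_product o (a (g i)^-1%g o) (a x o))%R.
apply: (@conv_decay _ _ _ _ be mu_sym g (fun i x => A i x || B i x)).
- by move=> i /gP[].
- move=> i x i10; have [_ gK _] := gP i i10.
  have := gromov_product_base o (a (g i) o) (a x o).
  rewrite gromov_productC -(gromov_product_act a (g i)^-1%g (a (g i) o)).
  rewrite actK -actM -/(displ a o _) /A /B => E.
  case: (lerP K (gromov_product o (a x o) (a (g i) o))) => [Kx|Kx].
    by rewrite gromov_productC Kx.
  apply/orP; right; apply/orP; right; lra.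
move=> x; apply: (@le_trans _ _ (\sum_(i < 10) ((A i x)%:R + (B i x)%:R))%R).
  by apply: ler_sum => i _; case: (A i x); case: (B i x); rewrite ?addr0 ?add0r ?lerDl.
rewrite big_split/= (_ : 2 = 1 + 1)%R//; apply: lerD;
  [apply: (@exclusive_sum (A^~ x))|apply: (@exclusive_sum (B^~ x))].
  move=> i j i10 j10 Ai Aj; apply/eqP; apply: contrapT => /negP ij.
  have [_ _ /(_ j j10 ij)[+ _]] := gP i i10.
  apply/negP; rewrite -leNgt; apply: (gromov_product_trans hyp (y := a x o)) => //.
  by rewrite gromov_productC.
move=> i j i10 j10 Ai Aj; apply/eqP; apply: contrapT => /negP ij.
have [_ _ /(_ j j10 ij)[_ +]] := gP i i10.
apply/negP; rewrite -leNgt; apply: (gromov_product_trans hyp (y := a x o)) => //.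
by rewrite gromov_productC.
Qed.

Lemma walk_displ n :
  walk_mean n (fun g => (displ a o g)%:E) <=
  n%:R%:E * walk_mean 1 (fun g => (displ a o g)%:E).
Proof.
have D0 g : 0 <= (displ a o g)%:E by rewrite lee_fin displ_ge0.
elim: n => [|n IHn]; first by rewrite walk_mean0// displ1 mul0e.
rewrite walk_meanS//.
apply: le_trans (_ : walk_mean n (fun g => (displ a o g)%:E +
   walk_mean 1 (fun g => (displ a o g)%:E)) <= _).
  apply: walk_mean_le => g.
  rewrite -[X in X + _](walk_mean_cst mu be 1 (D0 g)) -walk_meanD//.
  by apply: walk_mean_le => h; rewrite -EFinD lee_fin displM.
rewrite walk_meanD//; last by move=> _; exact: walk_mean_ge0.
rewrite (walk_mean_cst mu be)//; last exact: walk_mean_ge0.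
by rewrite -natr1 EFinD ge0_muleDl ?lee_fin// mul1e leeD2r.
Qed.

(** For all [z] and [z'], with probability close to one uniformly in [z] and
    [z'], the random walk brings [z] and [z'] close to each other: otherwise it
    would stay near the line from [z] to [z'], which has linearly many points
    while the walk has at most linear speed and exponentially small atoms. *)
Lemma walk_contraction (r eps : R) : (0 < eps)%R -> exists k, forall z z' : gromov_boundary o,
  walk_mean k (fun g => (`[< ~ bd_near r (bd_act a g z) (bd_act a g z') >])%:R%:E)
    <= eps%:E.
Proof.
move=> eps0; have [M [kappa [M0 k01 decay]]] := walk_decay.
have [N NP] := far_count o delta_ge0 hyp properX geoa r.
have D0 g : 0 <= (displ a o g)%:E by rewrite lee_fin displ_ge0.
have [m [m0 mE]] : exists m : R, (0 <= m)%R /\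
    walk_mean 1 (fun g => (displ a o g)%:E) = m%:E.
  have W0 := walk_mean_ge0 mu 1 D0.
  have Wfin : walk_mean 1 (fun g => (displ a o g)%:E) \is a fin_num.
    rewrite ge0_fin_numE//; apply: le_lt_trans mom; apply: le_esum => g _.
    by rewrite conv1.
  exists (fine (walk_mean 1 (fun g => (displ a o g)%:E))).
  by rewrite fine_ge0// fineK.
(* With [T = k * L], the walk leaves the ball of radius [T] with probability at
   most [m / L <= eps / 2]; the far elements in this ball are at most [j * Q], each
   of probability at most [kappa ^+ j]. *)
pose L := (2 * m / eps + 1)%R.
have L0 : (0 < L)%R by rewrite ltr_wpDl// divr_ge0 ?mulr_ge0// ltW.
pose Q := ((4 * M%:R * L + 1) * N%:R)%R.
have Q0 : (0 <= Q)%R by rewrite mulr_ge0// addr_ge0// !mulr_ge0// ltW.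
have [|j j0 jP] := linear_expr_small k01 (eta := (eps / (2 * (Q + 1)))%R).
  by rewrite divr_gt0// mulr_gt0// ltr_wpDl.
pose k := (j * M + j * M)%N; exists k => z z'.
pose T := (k%:R * L)%R.
have k0 : (0 < k)%N by rewrite addn_gt0 muln_gt0 j0 M0.
have T0 : (0 < T)%R by rewrite mulr_gt0// ltr0n.
pose S := [set g | displ a o g <= T /\ ~ bd_near r (bd_act a g z) (bd_act a g z')]%R.
have /finite_fsetP[A AE] : finite_set S.
  by apply: sub_finite_set (finite_displ o properX geoa T) => g [].
have SA : (#|` A| <= (Num.truncn (2 * T)).+1 * N)%N.
  apply: (NP z z' T (enum_fset A)); [exact: ltW|exact: fset_uniq|].
  by move=> g gA; have : S g by rewrite AE.
apply: le_trans (_ : walk_mean k (fun g => (g \in S)%:R%:E +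
    (T^-1)%:E * (displ a o g)%:E) <= _).
  apply: walk_mean_le => g; case: asboolP => far; last first.
    by rewrite mulr0n -EFinM adde_ge0 ?lee_fin// mulr_ge0 ?displ_ge0// invr_ge0 ltW.
  case: (lerP (displ a o g) T) => gT.
    have -> : (g \in S) = true by apply/mem_set; split.
    by rewrite -EFinM leeDl// lee_fin mulr_ge0 ?displ_ge0// invr_ge0 ltW.
  apply: (@le_trans _ _ ((T^-1)%:E * (displ a o g)%:E)).
    by rewrite -EFinM lee_fin mulrC ler_pdivlMr// mul1r ltW.
  by rewrite leeDr// lee_fin.
rewrite walk_meanD => [|g|g]; last 2 first.
- by rewrite lee_fin.
- by rewrite mule_ge0// lee_fin invr_ge0 ltW.
rewrite walk_meanZ ?invr_ge0 ?(ltW T0)//.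
have -> : (eps = eps / 2 + eps / 2)%R by lra.
rewrite EFinD; apply: leeD.
  have -> : walk_mean k (fun g => (g \in S)%:R%:E) = \esum_(g in S) conv k g.
    rewrite [RHS]esum_mkcond; apply: eq_esum => g _.
    by case: ifP => _; rewrite ?mul1e ?mul0e.
  apply: le_trans (_ : \esum_(g in S) (kappa ^+ j)%:E <= _).
    by apply: le_esum => g _; exact: decay.
  have kj0 : (0 <= kappa ^+ j)%R by rewrite exprn_ge0//; have /andP[] := k01.
  rewrite esum_fset//; last by rewrite AE; exact: finite_fset.
  rewrite AE -fsbig_seq ?fset_uniq// sumEFin lee_fin big_const_seq count_predT iter_addr addr0.
  have : (#|` A|%:R <= (2 * T + 1) * N%:R :> R)%R.
    apply: le_trans (_ : ((Num.truncn (2 * T)).+1 * N)%:R <= _)%R.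
      by rewrite ler_nat.
    rewrite natrM ler_wpM2r// -natr1 lerD2r truncn_le.
    by rewrite mulr_ge0// ltW.
  have jR : (1 <= j%:R :> R)%R by rewrite ler1n.
  have TE : (2 * T + 1 <= j%:R * (4 * M%:R * L + 1))%R.
    by rewrite /T /k natrD natrM; lra.
  move=> sizeA; rewrite -[leLHS]mulr_natr.
  have H1 : ((size A)%:R <= j%:R * Q :> R)%R.
    apply: le_trans sizeA _; rewrite /Q mulrA; exact: ler_wpM2r.
  apply: (@le_trans _ _ (kappa ^+ j * (j%:R * Q))%R); first exact: ler_wpM2l.
  apply: (@le_trans _ _ (eps / (2 * (Q + 1)) * Q)%R).
    by rewrite mulrA [(kappa ^+ j * _)%R]mulrC; exact: ler_wpM2r.
  have Q1 : (0 < Q + 1)%R by rewrite ltr_wpDl.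
  have -> : (eps / (2 * (Q + 1)) * Q = eps / 2 * (Q / (Q + 1)))%R.
    by field; rewrite gt_eqF.
  apply: ler_piMr; first by rewrite divr_ge0// ltW.
  by rewrite ler_pdivrMr// mul1r lerDl.
apply: le_trans (_ : (T^-1)%:E * (k%:R%:E * m%:E) <= _).
  apply: lee_wpmul2l; first by rewrite lee_fin invr_ge0 ltW.
  by rewrite -mE; exact: walk_displ.
rewrite -!EFinM lee_fin /T invfM mulrCA !mulrA divff ?mul1r; last first.
  by rewrite pnatr_eq0 -lt0n.
rewrite mulrC ler_pdivrMr// /L mulrDr mulr1.
rewrite (_ : eps / 2 * (2 * m / eps) = m)%R; last by field; rewrite gt_eqF.
by rewrite lerDl divr_ge0// ltW.
Qed.

End contraction.

(** * The law of the random walk *)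

Section countable_partition.
Context {R : realType} {I : choiceType} (e : nat -> I) (be : bijective e).
Context d (T : measurableType d) (m : {measure set T -> \bar R}).
Local Open Scope ereal_scope.

Lemma measurable_bigcup_enum (A : I -> set T) (J : set I) :
  (forall i, measurable (A i)) -> measurable (\bigcup_(i in J) A i).
Proof.
move=> mA; have [e' eK e'K] := be.
have -> : \bigcup_(i in J) A i = \bigcup_(n in e @^-1` J) A (e n).
  apply/seteqP; split=> [t [i Ji it]|t [n Jn nt]]; last by exists (e n).
  by exists (e' i); rewrite /= e'K.
exact: bigcup_measurable.
Qed.

Lemma integral_esum (X : T -> I) (F : I -> \bar R) :
  (forall i, measurable (X @^-1` [set i])) -> (forall i, 0 <= F i) ->
  \int[m]_w F (X w) = \esum_(i in [set: I]) (F i * m (X @^-1` [set i])).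
Proof.
move=> mX F0; have [e' eK e'K] := be.
have XE (J : set I) : X @^-1` J = \bigcup_(i in J) (X @^-1` [set i]).
  apply/seteqP; split=> [w Jw|w [i Ji /= Xi]]; first by exists (X w).
  by rewrite /= Xi.
have mXJ J : measurable (X @^-1` J) by rewrite XE; exact: measurable_bigcup_enum.
have -> : [set: T] = \bigcup_n (X @^-1` [set e n]).
  by apply/seteqP; split=> // w _; exists (e' (X w)) => //=; rewrite e'K.
rewrite ge0_integral_bigcup//; last 2 first.
- move=> _ Y _; apply: measurableI; last exact: (mXJ (F @^-1` Y)).
  by apply: bigcupT_measurable => n; exact: mX.
- by move=> i j _ _ [w [/= -> /(can_inj eK)]].
transitivity (\sum_(n <oo) (F (e n) * m (X @^-1` [set e n]))).
  apply: eq_eseriesr => n _; rewrite -integral_cst//.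
  by apply: eq_integral => w; rewrite inE /= => ->.
rewrite nneseries_esumT; last by move=> n; rewrite mule_ge0.
symmetry; apply: reindex_esum.
by split=> // [i j _ _|i _]; [exact: can_inj|exists (e' i)].
Qed.

End countable_partition.

Lemma maxe_ge0Ml (R : realType) (x y : \bar R) : (0 <= y ->
  maxe x 0 * y = maxe (x * y) 0)%E.
Proof.
move=> y0; have [x0|x0] := leP x 0%E.
  by rewrite mul0e max_r// mule_le0_ge0.
by rewrite max_l// mule_ge0// ltW.
Qed.

Section law.
Context {R : realType} {G : groupType} (mu : probability (discrete_group G) R).
Context (e : nat -> G) (be : bijective e).
Context d (Omega : measurableType d) (P : probability Omega R).
Context (H : nat -> {RV P >-> discrete_group G}) (iidH : iid_of_law H mu).
Local Open Scope ereal_scope.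

Lemma measurable_increment i (A : set G) : measurable (H i @^-1` A).
Proof. by rewrite -[X in measurable X]setTI; exact: measurable_funPT. Qed.

Lemma random_walkS n w : random_walk H n.+1 w = (random_walk H n w * H n w)%g.
Proof. by rewrite /random_walk big_ord_recr. Qed.

Lemma random_walkS_preimage n g : random_walk H n.+1 @^-1` [set g] =
  \bigcup_h (random_walk H n @^-1` [set h] `&` H n @^-1` [set (h^-1 * g)%g]).
Proof.
apply/seteqP; split=> [w /= <-|w [h _ [/= <- Hn]]].
  by exists (random_walk H n w) => //; split=> //=; rewrite random_walkS mulKg.
by rewrite random_walkS Hn mulVKg.
Qed.

Lemma measurable_random_walk n g : measurable (random_walk H n @^-1` [set g]).
Proof.
elim: n g => [|n IHn] g.
  have [g1|g1] := eqVneq g 1%g.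
    rewrite (_ : _ @^-1` _ = setT)//; apply/seteqP; split=> // w _ /=.
    by rewrite /random_walk big_ord0.
  rewrite (_ : _ @^-1` _ = set0)//; apply/seteqP; split=> // w /=.
  by rewrite /random_walk big_ord0 => /esym/eqP; rewrite (negPf g1).
rewrite random_walkS_preimage; apply: (measurable_bigcup_enum be) => h.
by apply: measurableI => //; exact: measurable_increment.
Qed.

(** The induction needs the joint law with the later increments. *)
Lemma random_walk_indep n g (s : seq nat) (A : nat -> set (discrete_group G)) :
  uniq s -> (forall i, i \in s -> (n <= i)%N) ->
  P (random_walk H n @^-1` [set g] `&` \big[setI/setT]_(i <- s) (H i @^-1` A i)) =
  convolution_power mu n g * \prod_(i <- s) P (H i @^-1` A i).
Proof.
have [law indep] := iidH.
elim: n g s A => [|n IHn] g s A us sn.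
  rewrite conv0; case: eqVneq => [->|g1].
    rewrite mul1e -indep//; congr (P _); rewrite (_ : _ @^-1` _ = setT) ?setTI//.
    by apply/seteqP; split=> // w _; rewrite /= /random_walk big_ord0.
  rewrite mul0e (_ : _ `&` _ = set0) ?measure0//.
  apply/seteqP; split=> // w [/=]; rewrite /random_walk big_ord0 => /esym/eqP.
  by rewrite (negPf g1).
(* The event decomposes according to the position [h] at time [n], which prescribes
   the increment of index [n]. *)
pose A' h i := if i == n then [set (h^-1 * g)%g] else A i.
have nus : uniq (n :: s).
  by rewrite /= us andbT; apply/negP => /sn; rewrite ltnn.
have sA' h i : i \in s -> A' h i = A i.
  by move=> /sn ni; rewrite /A' gtn_eqF.
have bigA' h : \big[setI/setT]_(i <- n :: s) (H i @^-1` A' h i) =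
    H n @^-1` [set (h^-1 * g)%g] `&` \big[setI/setT]_(i <- s) (H i @^-1` A i).
  rewrite big_cons {1}/A' eqxx; congr (_ `&` _).
  by rewrite big_seq [RHS]big_seq; apply: eq_bigr => i /sA' ->.
have mbig : measurable (\big[setI/setT]_(i <- s) (H i @^-1` A i)).
  by apply: bigsetI_measurable => i _; exact: measurable_increment.
rewrite random_walkS_preimage setI_bigcupl.
rewrite (measure_esum _ be)/=; last 2 first.
- move=> h; apply: measurableI => //; apply: measurableI.
    exact: measurable_random_walk.
  exact: measurable_increment.
- by move=> h k [w [[[/= <- _] _] [[/= <- _] _]]].
rewrite convS muleC -esumZl; last 2 first.
- by apply: prode_ge0 => i _; exact: measure_ge0.
- by move=> h; rewrite mule_ge0// conv_ge0.
apply: eq_esum => h _; rewrite -setIA -bigA' IHn//; last first.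
  by move=> i; rewrite inE => /orP[/eqP ->//|/sn/ltnW].
rewrite big_cons {1}/A' eqxx.
have -> : P (H n @^-1` [set (h^-1 * g)%g]) = mu [set (h^-1 * g)%g] by exact: law.
rewrite [RHS]muleC -muleA; congr (_ * (_ * _)).
by rewrite big_seq [RHS]big_seq; apply: eq_bigr => i /sA' ->.
Qed.

Lemma random_walk_law n g :
  P (random_walk H n @^-1` [set g]) = convolution_power mu n g.
Proof.
have := @random_walk_indep n g [::] (fun=> setT) isT.
by rewrite !big_nil setIT mule1; apply.
Qed.

Lemma expectation_random_walk n (phi : G -> R) :
  'E_P[fun w => phi (random_walk H n w)] =
  signed_esum (fun g => (phi g)%:E * convolution_power mu n g).
Proof.
rewrite unlock /signed_esum integralE.
have fE (F : G -> \bar R) : (forall g, 0 <= F g) ->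
    \int[P]_w F (random_walk H n w) =
    \esum_(g in [set: G]) (F g * convolution_power mu n g).
  move=> F0; rewrite (integral_esum be)//; last exact: measurable_random_walk.
  by apply: eq_esum => g _; rewrite -random_walk_law.
under eq_integral do rewrite funeposE.
under [X in _ - X]eq_integral do rewrite funenegE.
rewrite (fE (fun g => maxe (phi g)%:E 0)) => [|g]; last by rewrite le_max lexx orbT.
rewrite (fE (fun g => maxe (- (phi g)%:E) 0)) => [|g]; last by rewrite le_max lexx orbT.
congr (_ - _); apply: eq_esum => g _.
  by rewrite funeposE maxe_ge0Ml// conv_ge0.
by rewrite funenegE -mulNe maxe_ge0Ml// conv_ge0.
Qed.

End law.

(** * Measurability on the boundary *)

Section measures.
Context {R : realType} {I : choiceType} (e : nat -> I) (be : bijective e).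
Context d (T : measurableType d) (nu : {measure set T -> \bar R}).
Local Open Scope ereal_scope.

Lemma esum_enum (f : I -> \bar R) : (forall i, 0 <= f i) ->
  \esum_(i in [set: I]) f i = \sum_(n <oo) f (e n).
Proof.
move=> f0; have [e' eK e'K] := be.
rewrite nneseries_esumT//; apply: reindex_esum.
by split=> // [i j _ _|i _]; [exact: can_inj|exists (e' i)].
Qed.

Lemma measurable_esum (h : I -> T -> \bar R) :
  (forall i, measurable_fun setT (h i)) -> (forall i t, 0 <= h i t) ->
  measurable_fun setT (fun t => \esum_(i in [set: I]) h i t).
Proof.
move=> mh h0; apply: (eq_measurable_fun (fun t => \sum_(n <oo) h (e n) t)).
  by move=> t _; rewrite esum_enum.
exact: ge0_emeasurable_sum.
Qed.

Lemma esum_integral (h : I -> T -> \bar R) :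
  (forall i, measurable_fun setT (h i)) -> (forall i t, 0 <= h i t) ->
  \esum_(i in [set: I]) \int[nu]_t h i t =
  \int[nu]_t \esum_(i in [set: I]) h i t.
Proof.
move=> mh h0; rewrite esum_enum; last by move=> i; exact: integral_ge0.
rewrite -integral_nneseries//.
by apply: eq_integral => t _; rewrite esum_enum.
Qed.

(** Integration of a decomposition of [nu] as a countable sum of multiples of its
    own images. *)
Lemma integral_decomposition (c : I -> R) (psi : I -> T -> T) (f : T -> \bar R) :
  (forall i, (0 <= c i)%R) -> (forall i, measurable_fun setT (psi i)) ->
  (forall A, measurable A ->
     nu A = \esum_(i in [set: I]) ((c i)%:E * nu (psi i @^-1` A))) ->
  (forall t, 0 <= f t) -> measurable_fun setT f ->
  \int[nu]_t f t = \esum_(i in [set: I]) ((c i)%:E * \int[nu]_t f (psi i t)).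
Proof.
move=> c0 mpsi nuE f0 mf.
pose pm i : {measure set T -> \bar R} :=
  measure_function_pushforward__canonical__measure_function_Measure nu (mpsi i).
pose m n : {measure set T -> \bar R} := mscale (NngNum (c0 (e n))) (pm (e n)).
rewrite esum_enum; last first.
  by move=> i; rewrite mule_ge0 ?lee_fin//; exact: integral_ge0.
transitivity (\int[mseries m 0]_t f t).
  apply: eq_measure_integral => A mA _; rewrite nuE// esum_enum//.
  by move=> i; rewrite mule_ge0 ?lee_fin.
rewrite ge0_integral_measure_series//; apply: eq_eseriesr => n _.
by rewrite ge0_integral_mscale//= ge0_integral_pushforward.
Qed.

End measures.

Section boundary_measurable.
Context {R : realType} {X : metricType R} (o : X).
Context (delta : R) (delta_ge0 : 0 <= delta).
Context (hyp : delta_hyperbolic X delta).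
Context (cptX : compact [set: gromov_boundary o]) (xi0 : gromov_boundary o).
Local Notation bd := (gromov_boundary o).
Local Notation bo := (borel xi0).

Lemma open_measurable_bd (U : set bd) : open U -> measurable (U : set bo).
Proof. by move=> oU; apply: sub_sigma_algebra. Qed.

Lemma continuous_measurable_bd (f : bd -> bd) : continuous f ->
  measurable_fun setT (f : bo -> bo).
Proof.
move=> /continuousP cf; apply: (@measurability _ _ bo bo setT f (@open bd)) => //.
by move=> _ [U oU <-]; rewrite setTI; apply: open_measurable_bd; exact: cf.
Qed.

(** A countable basis of the topology of the boundary. *)
Lemma bd_countable_basis : exists U : nat -> nat -> set bd,
  (forall n i, open (U n i)) /\
  forall r z, exists n i, U n i z /\ U n i `<=` bd_near r z.
Proof.
have d0 := delta_ge0.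
have /choice[D DP] : forall n : nat, exists D : {fset bd},
    [set: bd] `<=` \bigcup_(z in [set` D]) bd_ball n%:R z.
  move=> n; have : compact [set: bo] by exact: cptX.
  rewrite compact_cover.
  move=> /(_ bd setT (bd_ball n%:R)) [z _|z _|D _ DP].
  - exact: (open_bd_ball delta_ge0 hyp).
  - by exists z => //; apply: (bd_ball_near delta_ge0 hyp); exact: bd_near_refl.
  - by exists D.
exists (fun n i => bd_ball n%:R (nth xi0 (enum_fset (D n)) i)); split.
  by move=> n i; exact: (open_bd_ball delta_ge0 hyp).
move=> r z; have [n nr] := exists_nat_ge (r + 1 + (1 + 3 * delta)).
have [c cD cz] := DP n z I.
exists n, (index c (enum_fset (D n))); rewrite nth_index//; split=> // w cw.
have zc := bd_near_sym (bd_ball_sub cz).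
have cw' := bd_ball_sub cw.
apply: (bd_near_le (r := n%:R - 1 - (1 + 3 * delta))); first by lra.
apply: (bd_near_trans delta_ge0 hyp zc).
by apply: bd_near_le cw'; rewrite gerBl.
Qed.

Lemma open_measurable_bd2 (W : set (bd * bd)) : open W ->
  measurable (W : set (bo * bo)).
Proof.
have [U [oU UP]] := bd_countable_basis.
move=> oW; pose V n i m j : set (bo * bo) :=
  if `[< U n i `*` U m j `<=` W >] then U n i `*` U m j else set0.
have -> : W = \bigcup_n \bigcup_i \bigcup_m \bigcup_j V n i m j.
  apply/seteqP; split=> [[z w] Wzw|p [n _ [i _ [m _ [j _]]]]]; last first.
    by rewrite /V; case: asboolP => // sub /sub.
  have : nbhs (z, w) W by exact: open_nbhs_nbhs.
  move=> [[A B] /= [/(nbhs_bdP delta_ge0 hyp)[r rA]]].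
  move=> /(nbhs_bdP delta_ge0 hyp)[s sB] AB.
  have [n [i [zn nz]]] := UP r z; have [m [j [wm mw]]] := UP s w.
  exists n => //; exists i => //; exists m => //; exists j => //.
  rewrite /V asboolT//.
  by move=> [z' w'] [/= /nz/rA Az /mw/sB Bw]; apply: AB.
do 4 (apply: bigcupT_measurable => ?); rewrite /V; case: asboolP => // _.
by apply: measurableX; apply: open_measurable_bd.
Qed.

Lemma continuous_measurable_bd2 (Phi : bd * bd -> R) : continuous Phi ->
  measurable_fun setT (Phi : bo * bo -> R).
Proof.
move=> /continuousP cPhi.
apply: (@measurability _ _ _ _ setT (Phi : bo * bo -> R) _
  (RGenOInfty.measurableE R)) => _ [_ [x ->] <-].
rewrite setTI; apply: open_measurable_bd2; apply: cPhi.
exact: interval_open.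
Qed.

End boundary_measurable.

(** * Equidistribution *)

Section equidistribution.
Context {R : realType} {G : groupType} {X : metricType R}.
Context (a : isometric_action G X) (o : X) (delta : R) (delta_ge0 : 0 <= delta).
Context (hyp : delta_hyperbolic X delta).
Context (mu : probability (discrete_group G) R).
Context (e : nat -> G) (be : bijective e) (mu_sym : symmetric_measure mu).
Context (xi0 : gromov_boundary o) (nu : probability (borel xi0) R).
Context (stat : stationary mu a nu).
Local Notation bd := (gromov_boundary o).
Local Notation bo := (borel xi0).
Local Notation conv := (convolution_power mu).
Local Notation walk_mean := (walk_mean mu).
Local Open Scope ereal_scope.

(** The contraction property of the random walk at time [k], see
    [walk_contraction]. *)
Definition contracts (r eps : R) (k : nat) := forall z z' : bd,
  walk_mean k (fun g => (`[< ~ bd_near r (bd_act a g z) (bd_act a g z') >])%:R%:E)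
    <= eps%:E.

Lemma measurable_bd_act g : measurable_fun setT (bd_act a g : bo -> bo).
Proof.
apply: continuous_measurable_bd; exact: bd_act_continuous delta_ge0 hyp g.
Qed.

Lemma measurable_bd_act_preimage g (A : set bo) :
  measurable A -> measurable (bd_act a g @^-1` A : set bo).
Proof.
by move=> mA; rewrite -[X in measurable X]setTI; exact: measurable_bd_act.
Qed.

Lemma stationary_conv k (A : set bo) : measurable A ->
  nu A = walk_mean k (fun g => nu (bd_act a g @^-1` A)).
Proof.
elim: k A => [|k IHk] A mA.
  rewrite walk_mean0//; congr (nu _).
  by apply/seteqP; split=> z; rewrite /= bd_act1.
rewrite walk_meanS// {1}IHk//; apply: eq_walk_mean => g.
rewrite -(stat (measurable_bd_act_preimage g mA)); apply: eq_esum => h _.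
rewrite conv1 muleC; congr (nu _ * _).
by apply/seteqP; split=> z; rewrite /= bd_actM.
Qed.

(** A function [f] with a modulus of continuity integrates, up to a small error,
    at least to the mean of [f] at time [k] along any orbit of the random walk. *)
Lemma walk_mean_le_integral (f : bd -> \bar R) (B r eps1 eps2 : R) k z0 :
  (0 <= B)%R -> (0 <= eps1)%R -> (0 <= eps2)%R ->
  (forall z, 0 <= f z <= B%:E) -> measurable_fun setT (f : bo -> \bar R) ->
  (forall z z', bd_near r z z' -> f z <= f z' + eps1%:E) ->
  contracts (r + (1 + 3 * delta)) eps2 k ->
  walk_mean k (fun g => f (bd_act a g z0)) <=
  \int[nu]_z f z + (eps1 + B * eps2)%:E.
Proof.
move=> B0 e10 e20 fB mf fr ctr.
have f0 z : 0 <= f z by have /andP[] := fB z.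
pose far g : set bo := ~` (bd_act a g @^-1` bd_ball r (bd_act a g z0)).
have mfar g : measurable (far g).
  apply: measurableC; apply: measurable_bd_act_preimage.
  by apply: open_measurable_bd; exact: (open_bd_ball delta_ge0 hyp).
have mfg g : measurable_fun setT (fun z : bo => f (bd_act a g z)).
  exact: measurableT_comp mf (measurable_bd_act g).
have pointwise g (z : bo) : f (bd_act a g z0) <=
    f (bd_act a g z) + eps1%:E + B%:E * (\1_(far g) z)%:E.
  rewrite indicE; case: (boolP (z \in far g)) => zfar.
    rewrite mule1; have /andP[_ fz0] := fB (bd_act a g z0).
    by apply: le_trans fz0 _; rewrite leeDr// adde_ge0// lee_fin.
  rewrite mule0 adde0; apply: fr; apply: bd_ball_sub; apply: contrapT => nb.
  by move/negP: zfar; apply; apply/mem_set.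
have integrated g : f (bd_act a g z0) <=
    \int[nu]_z f (bd_act a g z) + eps1%:E + B%:E * nu (far g).
  have mind : measurable_fun setT (fun z : bo => (\1_(far g) z)%:E : \bar R).
    by apply/measurable_EFinP; exact: measurable_indic.
  have -> : f (bd_act a g z0) = \int[nu]_z cst (f (bd_act a g z0)) z.
    by rewrite integral_cst//= probability_setT mule1.
  have -> : nu (far g) = \int[nu]_z (\1_(far g) z)%:E.
    by rewrite integral_indic// setIT.
  have -> : eps1%:E = \int[nu]_z cst eps1%:E z.
    by rewrite integral_cst//= probability_setT mule1.
  have m1 : measurable_fun setT (fun z : bo => f (bd_act a g z) + cst eps1%:E z).
    exact: emeasurable_funD.
  have m2 : measurable_fun setT (fun z : bo => B%:E * (\1_(far g) z)%:E).
    exact: measurable_funeM.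
  have p1 (z : bo) : 0 <= f (bd_act a g z) + cst eps1%:E z.
    by rewrite adde_ge0// lee_fin.
  have p2 (z : bo) : 0 <= B%:E * (\1_(far g) z)%:E by rewrite mule_ge0// lee_fin.
  rewrite -ge0_integralD//.
  rewrite -ge0_integralZl_EFin//.
  rewrite -ge0_integralD//.
  apply: ge0_le_integral => //; [by move=> z _; exact: f0| |by move=> z _; exact: pointwise].
  exact: emeasurable_funD.
have far0 g : 0 <= nu (far g) by exact: measure_ge0.
apply: le_trans (walk_mean_le mu k integrated) _.
have i0 g : 0 <= \int[nu]_z f (bd_act a g z) by exact: integral_ge0.
rewrite walk_meanD => [|g|g]; last 2 first.
- by rewrite adde_ge0// lee_fin.
- by rewrite mule_ge0// lee_fin.
rewrite walk_meanD//.
rewrite (walk_mean_cst mu be) ?lee_fin// walk_meanZ//.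
rewrite EFinD -addeA EFinM; apply: leeD.
  rewrite (@integral_decomposition _ _ _ be _ _ nu (fun g => fine (conv k g))
    (fun g => bd_act a g : bo -> bo) f)//.
  - apply: le_esum => g _; rewrite muleC fineK//; exact: conv_fin be _ _.
  - by move=> g; rewrite fine_ge0// conv_ge0.
  - exact: measurable_bd_act.
  move=> A mA; apply: etrans (stationary_conv k mA) _; apply: eq_esum => g _.
  by rewrite muleC fineK//; exact: conv_fin be _ _.
apply: leeD2l; apply: lee_wpmul2l; first by rewrite lee_fin.
have mfk g : measurable_fun setT (fun z : bo => (\1_(far g) z)%:E * conv k g).
  rewrite -[conv k g]fineK ?(conv_fin mu be)//.
  apply: emeasurable_funM; last exact: measurable_cst.
  by apply/measurable_EFinP; exact: measurable_indic.
have -> : walk_mean k (fun g => nu (far g)) =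
    \int[nu]_z walk_mean k (fun g => (\1_(far g) z)%:E).
  rewrite -(esum_integral be).
  - apply: eq_esum => g _.
    transitivity (\int[nu]_z ((fine (conv k g))%:E * (\1_(far g) z)%:E)).
      rewrite ge0_integralZl_EFin//.
      + by rewrite integral_indic// setIT muleC fineK// (conv_fin mu be).
      + by apply/measurable_EFinP; exact: measurable_indic.
      + by rewrite fine_ge0// conv_ge0.
    by apply: eq_integral => z _; rewrite muleC fineK// (conv_fin mu be).
  - exact: mfk.
  - by move=> g z; rewrite mule_ge0 ?lee_fin// conv_ge0.
apply: le_trans (_ : \int[nu]_z cst eps2%:E z <= _); last first.
  by rewrite integral_cst//= probability_setT mule1.
apply: ge0_le_integral => //.
- by move=> z _; apply: walk_mean_ge0 => g; rewrite lee_fin.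
- by apply: (measurable_esum be) => // g z; rewrite mule_ge0 ?lee_fin// conv_ge0.
move=> z _; apply: le_trans (ctr z0 z); apply: walk_mean_le => g.
rewrite lee_fin indicE; case: (boolP (z \in far g)) => //.
rewrite inE => zfar; rewrite asboolT// => near; apply: zfar.
exact: (bd_ball_near delta_ge0 hyp).
Qed.


Lemma walk_mean_le_integral_later (f : bd -> \bar R) (B r eps1 eps2 : R) k n z0 :
  (0 <= B)%R -> (0 <= eps1)%R -> (0 <= eps2)%R ->
  (forall z, 0 <= f z <= B%:E) -> measurable_fun setT (f : bo -> \bar R) ->
  (forall z z', bd_near r z z' -> f z <= f z' + eps1%:E) ->
  contracts (r + (1 + 3 * delta)) eps2 k -> (k <= n)%N ->
  walk_mean n (fun g => f (bd_act a g z0)) <=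
  \int[nu]_z f z + (eps1 + B * eps2)%:E.
Proof.
move=> B0 e10 e20 fB mf fr ctr kn.
have f0 z : 0 <= f z by have /andP[] := fB z.
rewrite -(subnKC kn) walk_meanM// walk_mean_exchange//.
have I0 : 0 <= \int[nu]_z f z + (eps1 + B * eps2)%:E.
  rewrite adde_ge0//; first exact: integral_ge0.
  by rewrite lee_fin addr_ge0// mulr_ge0.
rewrite -[leRHS](walk_mean_cst mu be (n - k) I0); apply: walk_mean_le => h.
under eq_walk_mean do rewrite bd_actM.
exact: (walk_mean_le_integral (r := r)).
Qed.

Lemma walk_mean_affine n r s (F F' : G -> \bar R) : (0 <= r)%R -> (0 <= s)%R ->
  (forall g, 0 <= F g) -> (forall g, 0 <= F' g) ->
  walk_mean n (fun g => F g + (r%:E + s%:E * F' g)) =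
  walk_mean n F + (r%:E + s%:E * walk_mean n F').
Proof.
move=> r0 s0 F0 F'0; have sF0 g : 0 <= s%:E * F' g by rewrite mule_ge0.
rewrite (@walk_meanD _ _ mu n F (fun g => r%:E + s%:E * F' g))//; last first.
  by move=> g; rewrite adde_ge0.
rewrite (@walk_meanD _ _ mu n (fun=> r%:E) (fun g => s%:E * F' g))//.
by rewrite walk_meanZ// (walk_mean_cst mu be).
Qed.

(** The two coordinates are almost independent: for [g = h * y] with [h] of time [k],
    the point [g xi] is close to [h xi], while [g^-1 eta] is almost determined by
    [y]. *)
Lemma walk_mean2_le_integral (Psi : bd * bd -> R) (B : R) xi eta :
  (forall r eps, (0 < eps)%R -> exists k, contracts r eps k) ->
  (0 <= B)%R -> (forall p, 0 <= Psi p <= B)%R ->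
  measurable_fun setT (Psi : bo * bo -> R) ->
  (forall eps, (0 < eps)%R -> exists r, forall z z' w w',
     bd_near r z z' -> bd_near r w w' -> (`|Psi (z, w) - Psi (z', w')| <= eps)%R) ->
  forall eps, (0 < eps)%R -> exists n0, forall n, (n0 <= n)%N ->
  walk_mean n (fun g => (Psi (bd_act a g xi, bd_act a g^-1%g eta))%:E) <=
  \int[nu \x nu]_z (Psi z)%:E + eps%:E.
Proof.
move=> ctr B0 PsiB mPsi unif eps eps0.
have Psi0 p : (0 <= Psi p)%R by have /andP[] := PsiB p.
pose eps1 : R := (eps / 6)%R; have e1 : (0 < eps1)%R by rewrite divr_gt0.
pose eps2 : R := (eps / (6 * (B + 1)))%R.
have B1 : (0 < B + 1)%R by rewrite ltr_wpDl.
have e2 : (0 < eps2)%R by rewrite divr_gt0// mulr_gt0.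
have Be2 : (B * eps2 <= eps / 6)%R.
  have -> : (B * eps2 = eps / 6 * (B / (B + 1)))%R.
    by rewrite /eps2; field; rewrite gt_eqF.
  apply: ler_piMr; first by rewrite divr_ge0// ltW.
  by rewrite ler_pdivrMr// mul1r lerDl.
have [r rP] := unif _ e1.
have near_refl (z : bd) : bd_near r z z by exact: bd_near_refl.
have [k kP] := ctr (r + (1 + 3 * delta))%R _ e2.
exists (k + k)%N => n kn.
have km : (k <= n - k)%N by lia.
have -> : n = (k + (n - k))%N by lia.
move: (n - k)%N km => m km {n kn}.
pose c : R := (eps1 + B * eps2)%R.
have c0 : (0 <= c)%R by apply: addr_ge0; [exact: ltW|rewrite mulr_ge0// ltW].
have PE p : (Psi p)%:E <= B%:E /\ 0 <= (Psi p)%:E.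
  by have /andP[] := PsiB p; rewrite !lee_fin.
have mPsiE : measurable_fun setT (fun p : bo * bo => (Psi p)%:E : \bar R).
  exact/measurable_EFinP.
pose psi (z : bd) : \bar R := \int[nu]_w (Psi (z, w))%:E.
have mslice z : measurable_fun setT (fun w : bo => (Psi (z, w))%:E : \bar R).
  apply: (@measurableT_comp _ _ _ bo (bo * bo)%type _ _ setT (pair z) mPsiE).
  exact: (@pair1_measurable _ _ bo bo).
have psi0 z : 0 <= psi z by apply: integral_ge0 => w _; rewrite lee_fin.
have mpsi : measurable_fun setT (psi : bo -> \bar R).
  by apply: (measurable_fun_fubini_tonelli_F (m2 := nu)) mPsiE _ => p; rewrite lee_fin.
have cst_int (x : R) : \int[nu]_w cst x%:E w = x%:E.
  by rewrite integral_cst//= probability_setT mule1.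
have psiB z : 0 <= psi z <= B%:E.
  rewrite psi0 /= -(cst_int B); apply: ge0_le_integral => //.
  - by move=> w _; rewrite lee_fin.
  - by move=> w _; exact: (PE _).1.
have psir z z' : bd_near r z z' -> psi z <= psi z' + eps1%:E.
  move=> zz'; rewrite -(cst_int eps1) -ge0_integralD//; last 2 first.
  - by move=> w _; rewrite lee_fin.
  - by move=> w _; rewrite lee_fin ltW.
  apply: ge0_le_integral => //.
  - by move=> w _; rewrite lee_fin.
  - exact: emeasurable_funD.
  move=> w _; rewrite -EFinD lee_fin -lerBlDl.
  by apply: le_trans (ler_norm _) (rP _ _ _ _ zz' (near_refl w)).
pose F h y : \bar R := (Psi (bd_act a h xi, bd_act a (h * y)^-1%g eta))%:E.
pose bad h y : \bar R := (`[< ~ bd_near (r + (1 + 3 * delta)) (bd_act a h xi)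
   (bd_act a h (bd_act a y xi)) >])%:R%:E.
have F0 h y : 0 <= F h y by rewrite lee_fin.
have bad0 h y : 0 <= bad h y by rewrite lee_fin.
rewrite walk_meanM; last by move=> g; rewrite lee_fin.
apply: (@le_trans _ _ (walk_mean k (fun h => walk_mean m (fun y =>
    F h y + (eps1%:E + B%:E * bad h y))))).
  apply: walk_mean_le => h; apply: walk_mean_le => y.
  rewrite /F /bad bd_actM; case: asboolP => far.
    rewrite mule1 -!EFinD lee_fin; have /andP[_] := PsiB (bd_act a h (bd_act a y xi),
      bd_act a (h * y)^-1%g eta).
    move=> /le_trans; apply; rewrite addrA lerDr addr_ge0// ltW//.
  have near1 : bd_near r (bd_act a h xi) (bd_act a h (bd_act a y xi)).
    apply: bd_near_le (contrapT far); have d0 := delta_ge0; lra.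
  rewrite mule0 adde0 -EFinD lee_fin -lerBlDl.
  apply: le_trans (ler_norm _) _; rewrite distrC; exact: rP.
rewrite (eq_walk_mean mu k (F' := fun h => walk_mean m (F h) +
    (eps1%:E + B%:E * walk_mean m (bad h)))); last first.
  by move=> h; rewrite walk_mean_affine// ltW.
rewrite walk_mean_affine => [|||h|h]; [|exact: ltW|by []|exact: walk_mean_ge0..].
have step2 : walk_mean k (fun h => walk_mean m (bad h)) <= eps2%:E.
  have e20 : 0 <= eps2%:E by rewrite lee_fin ltW.
  rewrite walk_mean_exchange// -[leRHS](walk_mean_cst mu be m e20).
  apply: walk_mean_le => y; exact: kP.
have step3 h : walk_mean m (F h) <= psi (bd_act a h xi) + c%:E.
  pose f w : \bar R := (Psi (bd_act a h xi, w))%:E.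
  rewrite (eq_walk_mean mu m (F' := fun y => f (bd_act a y^-1%g (bd_act a h^-1%g eta)))).
    rewrite (@walk_meanV _ _ _ mu_sym m (fun y => f (bd_act a y (bd_act a h^-1%g eta)))).
      apply: (walk_mean_le_integral_later (r := r) (k := k)) => //.
      - exact: ltW.
      - exact: ltW.
      - by move=> w; have [-> ->] := PE (bd_act a h xi, w).
      - exact: mslice.
      move=> w w' ww'; rewrite -EFinD lee_fin -lerBlDl.
      by apply: le_trans (ler_norm _) (rP _ _ _ _ (near_refl _) ww').
    by move=> y; rewrite lee_fin.
  by move=> y; rewrite /F /f invgM bd_actM.
apply: (@le_trans _ _ (\int[nu]_z psi z + c%:E + c%:E + (eps1%:E + B%:E * eps2%:E))).
  apply: leeD; last by apply: leeD2l; apply: lee_wpmul2l.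
  apply: (@le_trans _ _ (walk_mean k (fun h => psi (bd_act a h xi) + c%:E))).
    exact: walk_mean_le.
  rewrite walk_meanD// (walk_mean_cst mu be) ?lee_fin//; apply: leeD2r.
  by apply: (walk_mean_le_integral (r := r)) => //; exact: ltW.
have -> : \int[nu \x nu]_z (Psi z)%:E = \int[nu]_z psi z.
  rewrite (fubini_tonelli1 (m1 := nu) (m2 := nu) (fun p => (Psi p)%:E) mPsiE)//.
move: (\int[nu]_z psi z) => J; rewrite -!addeA; apply: leeD2l.
rewrite -EFinM -!EFinD lee_fin /c /eps1.
by move: Be2; lra.
Qed.


(** The upper bound of [walk_mean2_le_integral], applied to [Psi] and to [B - Psi]. *)
Lemma walk_mean2_cvg (Psi : bd * bd -> R) (B : R) xi eta :
  (forall r eps, (0 < eps)%R -> exists k, contracts r eps k) ->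
  (0 <= B)%R -> (forall p, 0 <= Psi p <= B)%R ->
  measurable_fun setT (Psi : bo * bo -> R) ->
  (forall eps, (0 < eps)%R -> exists r, forall z z' w w',
     bd_near r z z' -> bd_near r w w' -> (`|Psi (z, w) - Psi (z', w')| <= eps)%R) ->
  (\int[nu \x nu]_z (Psi z)%:E \is a fin_num) /\
  (walk_mean n (fun g => (Psi (bd_act a g xi, bd_act a g^-1%g eta))%:E)
    @[n --> \oo] --> \int[nu \x nu]_z (Psi z)%:E).
Proof.
move=> ctr B0 PsiB mPsi unif.
pose Psi' p : R := (B - Psi p)%R.
have Psi0 p : (0 <= Psi p)%R by have /andP[] := PsiB p.
have Psi'B p : (0 <= Psi' p <= B)%R.
  by have /andP[? ?] := PsiB p; rewrite /Psi'; apply/andP; split; lra.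
have Psi'0 p : (0 <= Psi' p)%R by have /andP[] := Psi'B p.
have mPsi' : measurable_fun setT (Psi' : bo * bo -> R) by exact: measurable_funB.
have unif' eps : (0 < eps)%R -> exists r, forall z z' w w',
     bd_near r z z' -> bd_near r w w' -> (`|Psi' (z, w) - Psi' (z', w')| <= eps)%R.
  move=> /unif[r rP]; exists r => z z' w w' zz' ww'.
  rewrite (_ : _ - _ = - (Psi (z, w) - Psi (z', w')))%R; last by rewrite /Psi'; lra.
  by rewrite normrN; exact: rP.
pose F n := walk_mean n (fun g => (Psi (bd_act a g xi, bd_act a g^-1%g eta))%:E).
pose F' n := walk_mean n (fun g => (Psi' (bd_act a g xi, bd_act a g^-1%g eta))%:E).
pose J := \int[nu \x nu]_z (Psi z)%:E; pose J' := \int[nu \x nu]_z (Psi' z)%:E.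
have FF' n : F n + F' n = B%:E.
  rewrite -walk_meanD => [|g|g]; [|by rewrite lee_fin|by rewrite lee_fin].
  rewrite -[RHS](walk_mean_cst mu be n) ?lee_fin//; apply: eq_walk_mean => g.
  by rewrite -EFinD /Psi' addrC subrK.
have JJ' : J + J' = B%:E.
  rewrite -ge0_integralD//=; last 4 first.
  - by move=> p _; rewrite lee_fin.
  - exact/measurable_EFinP.
  - by move=> p _; rewrite lee_fin.
  - exact/measurable_EFinP.
  transitivity (\int[nu \x nu]_z cst B%:E z).
    by apply: eq_integral => p _; rewrite -EFinD /Psi' addrC subrK.
  rewrite integral_cst//= -setXTT product_measure1E//.
  transitivity (B%:E * (1 * 1)); last by rewrite !mule1.
  by congr (_ * (_ * _)); exact: probability_setT.
have F0 n : 0 <= F n by apply: walk_mean_ge0 => g; rewrite lee_fin.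
have F'0 n : 0 <= F' n by apply: walk_mean_ge0 => g; rewrite lee_fin.
have J0 : 0 <= J by apply: integral_ge0 => p _; rewrite lee_fin.
have J'0 : 0 <= J' by apply: integral_ge0 => p _; rewrite lee_fin.
have fin x y : 0 <= x -> 0 <= y -> x + y = B%:E -> x \is a fin_num /\ y \is a fin_num.
  by case: x => [x| |]//; case: y => [y| |].
have [Ffin F'fin] : (forall n, F n \is a fin_num) /\ (forall n, F' n \is a fin_num).
  by split=> n; have [] := fin _ _ (F0 n) (F'0 n) (FF' n).
have [Jfin J'fin] := fin _ _ J0 J'0 JJ'.
have up := walk_mean2_le_integral xi eta ctr B0 PsiB mPsi unif.
have up' := walk_mean2_le_integral xi eta ctr B0 Psi'B mPsi' unif'.
split=> //; rewrite -/J -(fineK Jfin); apply/fine_cvgP; split; first exact: nearW.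
apply/cvgrPdist_le => eps eps0.
have [n1 n1P] := up _ eps0; have [n2 n2P] := up' _ eps0.
exists (maxn n1 n2) => // n /=; rewrite geq_max => /andP[/n1P n1n /n2P n2n].
move: n1n n2n (FF' n) JJ'; rewrite -/(F n) -/(F' n) -/J -/J'.
rewrite -(fineK (Ffin n)) -(fineK (F'fin n)) -(fineK Jfin) -(fineK J'fin).
rewrite -!EFinD !lee_fin => ? ? [?] [?].
by rewrite ler_norml; apply/andP; split; lra.
Qed.

End equidistribution.

Unset Implicit Arguments.
Local Close Scope ring_scope.
Local Open Scope ereal_scope.

Theorem corollary3p1 (R : realType) (G : groupType) (X : metricType R) (o : X)
    (a : isometric_action G X) (mu : probability (discrete_group G) R)
    (xi0 : gromov_boundary o) (nu : probability (borel xi0) R)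
    (Phi : gromov_boundary o * gromov_boundary o -> R)
    (xi eta : gromov_boundary o) :
  proper_space X -> roughly_geodesic X -> gromov_hyperbolic X ->
  non_elementary [set: G] -> geometric_action a ->
  symmetric_measure mu -> non_elementary_measure mu -> first_moment mu a o ->
  stationary mu a nu ->
  continuous Phi ->
  let Sn (n : nat) : \bar R :=
    signed_esum (fun g : G =>
      (Phi (bd_act a g xi, bd_act a g^-1%g eta))%:E * convolution_power mu n g)
  in
  (forall (d : measure_display) (Omega : measurableType d)
          (P : probability Omega R) (H : nat -> {RV P >-> discrete_group G}),
     iid_of_law H mu -> forall n : nat,
       'E_P[fun w => Phi (bd_act a (random_walk H n w) xi,
                          bd_act a (random_walk H n w)^-1%g eta)] = Sn n)
  /\ (Sn n @[n --> \oo] --> \int[nu \x nu]_z (Phi z)%:E).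
Proof.
move=> properX roughX /gromov_hyperbolicP[delta delta0 hyp] neG geoa mu_sym ne_mu.
move=> mom stat cPhi Sn.
have infG : infinite_set [set: G].
  by move=> finG; apply: neG; exact: virtually_cyclic_finite.
have cntG : countable [set: G].
  have -> : [set: G] = \bigcup_n [set g | displ a o g <= n%:R]%R.
    apply/seteqP; split=> // g _; have [n gn] := exists_nat_ge (displ a o g).
    by exists n.
  apply: bigcup_countable => // n _; apply: finite_set_countable.
  exact: finite_displ.
have [e be] := countable_enum cntG infG.
split.
  move=> d Omega P H iidH n.
  exact: (expectation_random_walk be iidH n
    (fun g => Phi (bd_act a g xi, bd_act a g^-1%g eta))).
have cptX := bd_compact delta0 hyp properX roughX (o := o).
have [B B0 PhiB] := bd_bounded cptX cPhi.
have mPhi := continuous_measurable_bd2 delta0 hyp cptX (xi0 := xi0) cPhi.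
have unif := bd_unif_continuous delta0 hyp cptX cPhi.
have ctr r eps : (0 < eps)%R -> exists k, contracts a o mu r eps k.
  exact: (walk_contraction delta0 hyp properX roughX geoa be mu_sym ne_mu mom r).
(* The positive and negative parts of [Phi], for [s = false] and [s = true]. *)
have part (s : bool) : let Psi p := Num.max ((-1) ^+ s * Phi p)%R 0%R in
    (\int[nu \x nu]_z (Psi z)%:E \is a fin_num) /\
    (walk_mean mu n (fun g => (Psi (bd_act a g xi, bd_act a g^-1%g eta))%:E)
      @[n --> \oo] --> \int[nu \x nu]_z (Psi z)%:E).
  move=> Psi; apply: (walk_mean2_cvg delta0 hyp be mu_sym stat (B := B)) => //.
  - move=> p; rewrite /Psi le_max lexx orbT /= ge_max B0 andbT.
    by apply: le_trans (PhiB p); rewrite (le_trans (ler_norm _))// normrMsign.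
  - by apply: measurable_maxr => //; exact: measurable_funM.
  move=> eps /unif[r rP]; exists r => z z' w w' zz' ww'.
  apply: le_trans (rP _ _ _ _ zz' ww'); rewrite /Psi -[leRHS](normrMsign s) mulrBr.
  set u := (_ * _)%R; set v := (_ * _)%R.
  rewrite ler_norml; have := ler_norm (u - v)%R; have := ler_norm (v - u)%R.
  rewrite distrC; case: (lerP u 0%R); case: (lerP v 0%R) => v0 u0 a1 a2;
    by apply/andP; split; lra.
have [Jp cvgp] := part false; have [Jm cvgm] := part true.
have SnE n : Sn n =
    walk_mean mu n (fun g => (Num.max ((-1) ^+ false *
      Phi (bd_act a g xi, bd_act a g^-1%g eta))%R 0%R)%:E) -
    walk_mean mu n (fun g => (Num.max ((-1) ^+ true *
      Phi (bd_act a g xi, bd_act a g^-1%g eta))%R 0%R)%:E).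
  rewrite /Sn /signed_esum; congr (_ - _); apply: eq_esum => g _.
    by rewrite funeposE EFin_max expr0 mul1r maxe_ge0Ml// conv_ge0.
  by rewrite funenegE EFin_max expr1 mulN1r -mulNe -maxe_ge0Ml// conv_ge0.
have -> : \int[nu \x nu]_z (Phi z)%:E =
    \int[nu \x nu]_z (Num.max ((-1) ^+ false * Phi z)%R 0%R)%:E -
    \int[nu \x nu]_z (Num.max ((-1) ^+ true * Phi z)%R 0%R)%:E.
  rewrite integralE; congr (_ - _); apply: eq_integral => z _.
    by rewrite funeposE EFin_max expr0 mul1r.
  by rewrite funenegE EFin_max expr1 mulN1r.
under eq_fun do rewrite SnE.
by apply: cvgeB => //; exact: fin_num_adde_defr.
Qed.
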